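(* Let $n\ge2$ and $m\ge1$, and let $\mathbb{Z}/2^m$ act on the Cuntz algebra $\mathcal{O}_n$ by the restriction of the gauge action. Then $\mathrm{dim}^{\mathbb{Z}/2^m}_{\mathrm{WLT}}(\mathcal{O}_n)=1$.
   Context: $\mathcal{O}_n$ is the universal $C^*$-algebra generated by $S_1,\ldots,S_n$ with $S_i^*S_i=1$ for all $i$ and $\sum_{i=1}^nS_iS_i^*=1$. The gauge action of $\mathbb{S}^1$ is $S_i\mapsto zS_i$ for $z\in\mathbb{S}^1$; $\mathbb{Z}/2^m$ is identified with the $2^m$th roots of unity. Weak local-triviality dimension: let a compact group $G$ act on a unital $C^*$-algebra $A$. Equip $C(G)$ with $(\alpha_gf)(h)=f(hg)$ and $C_0((0,1])\otimes C(G)$ with the action on the second factor, and let $t$ be the identity function in $C_0((0,1])$. $\mathrm{dim}^G_{\mathrm{WLT}}(A)$ is the smallest $d\ge0$ for which there exist $G$-equivariant $*$-homomorphisms $\rho_0,\ldots,\rho_d:C_0((0,1])\otimes C(G)\to A$ such that $\sum_{i=0}^d\rho_i(t\otimes1)$ is invertible ($\infty$ if no such $d$ exists). *)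

(* Defs.v *)
From HB Require Import structures.
From mathcomp Require Import all_boot all_order all_algebra.
From mathcomp Require Import complex.
From mathcomp Require Import all_classical all_reals all_analysis.

Set Implicit Arguments.
Unset Strict Implicit.
Unset Printing Implicit Defensive.

Import Order.TTheory GRing.Theory Num.Theory.
Import numFieldNormedType.Exports.

Local Open Scope classical_set_scope.
Local Open Scope ring_scope.
Local Open Scope complex_scope.

(* The library has no structure that is at once an algebra and a normed module
   (they only meet at numDomainType), so the norm and its completeness are
   part of the mixin.  An algType has 1 != 0: C*-algebras are nonzero here. *)
HB.mixin Record isCStarAlgebra (R : realType) A of GRing.Algebra R[i] A := {
  star : A -> A;
  starD : forall x y, star (x + y) = star x + star y;
  starZ : forall (c : R[i]) x, star (c *: x) = c^* *: star x;
  starM : forall x y, star (x * y) = star y * star x;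
  starK : involutive star;
  cnorm : A -> R;
  cnorm_ge0 : forall x, 0 <= cnorm x;
  cnorm_eq0 : forall x, cnorm x = 0 -> x = 0;
  cnormZ : forall (c : R[i]) x, cnorm (c *: x) = complex.Re `|c| * cnorm x;
  cnormD_le : forall x y, cnorm (x + y) <= cnorm x + cnorm y;
  cnormM_le : forall x y, cnorm (x * y) <= cnorm x * cnorm y;
  cnorm_starM : forall x, cnorm (star x * x) = cnorm x ^+ 2;
  cnorm_complete : forall u : nat -> A,
    (forall e, 0 < e -> exists N : nat, forall i j : nat,
       (N <= i)%N -> (N <= j)%N -> cnorm (u i - u j) < e) ->
    exists l : A, forall e, 0 < e -> exists N : nat, forall i : nat,
       (N <= i)%N -> cnorm (u i - l) < e }.

#[short(type="cstarType")]
HB.structure Definition CStarAlgebra (R : realType) :=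
  {A of GRing.Algebra R[i] A & isCStarAlgebra R A}.

Record unital_star_hom (R : realType) (A B : cstarType R) (phi : A -> B)
    : Prop := UnitalStarHom {
  uhomD : forall x y, phi (x + y) = phi x + phi y;
  uhomZ : forall (c : R[i]) x, phi (c *: x) = c *: phi x;
  uhomM : forall x y, phi (x * y) = phi x * phi y;
  uhom1 : phi 1 = 1;
  uhom_star : forall x, phi (star x) = star (phi x) }.

Definition invertible (R : realType) (A : cstarType R) (a : A) : Prop :=
  exists b : A, b * a = 1 /\ a * b = 1.

HB.mixin Record isCompactGroup G of Topological G & Group G := {
  cgroup_mul_continuous : continuous (fun x : G * G => (x.1 * x.2)%g);
  cgroup_inv_continuous : continuous (fun x : G => (x^-1)%g);
  cgroup_hausdorff : hausdorff_space G;
  cgroup_compact : compact [set: G] }.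

#[short(type="compactGroupType")]
HB.structure Definition CompactGroup :=
  {G of Topological G & Group G & isCompactGroup G}.

Record cstar_action (R : realType) (G : compactGroupType) (A : cstarType R) :=
  CStarAction {
    act :> G -> A -> A;
    act_hom : forall g, unital_star_hom (act g);
    act1 : forall a, act 1%g a = a;
    actM : forall g h a, act (g * h)%g a = act g (act h a);
    act_continuous : forall a g e, 0 < e ->
    \forall h \near g, cnorm (act h a - act g a) < e }.

(* Topologies and continuity on the complex numbers go through the regular
   module R[i]^o, which is where the library puts its normed structure. *)
Definition C0 (R : realType) (X : topologicalType) (f : X -> R[i]^o) : Prop :=
  continuous f /\
  (forall e : R[i], 0 < e ->
     exists2 K : set X, compact K & forall x, ~ K x -> `|f x| < e).

(* *-homomorphisms C_0(X) -> A; C_0(X) is not unital in general, and the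
   values of rho outside C_0(X) are irrelevant. *)
Record C0_star_hom (R : realType) (X : topologicalType) (A : cstarType R)
    (rho : (X -> R[i]^o) -> A) : Prop := C0StarHom {
  C0homD : forall f g, C0 f -> C0 g ->
    rho (fun x => f x + g x) = rho f + rho g;
  C0homZ : forall (c : R[i]) f, C0 f -> rho (fun x => c * f x) = c *: rho f;
  C0homM : forall f g, C0 f -> C0 g ->
    rho (fun x => f x * g x) = rho f * rho g;
  C0hom_star : forall f, C0 f -> rho (fun x => (f x)^*) = star (rho f) }.

Definition unit_Ioc (R : realType) : topologicalType :=
  set_type (`]0, 1]%classic : set R).

(* C_0((0,1]) (x) C(G) is C_0((0,1] * G), with phi (x) f being the function
   (r, h) |-> phi r * f h. *)
Definition cone (R : realType) (G : topologicalType) : topologicalType :=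
  (unit_Ioc R * G)%type.

Definition tensor (R : realType) (G : topologicalType)
    (phi : unit_Ioc R -> R[i]^o) (f : G -> R[i]^o) : cone R G -> R[i]^o :=
  fun x => phi x.1 * f x.2.

Definition cone_id (R : realType) : unit_Ioc R -> R[i]^o :=
  fun r => (set_val r)%:C.

Definition translate (R : realType) (G : compactGroupType) (g : G)
    (F : cone R G -> R[i]^o) : cone R G -> R[i]^o :=
  fun x => F (x.1, (x.2 * g)%g).

Definition equivariant (R : realType) (G : compactGroupType) (A : cstarType R)
    (al : cstar_action G A) (rho : (cone R G -> R[i]^o) -> A) : Prop :=
  forall g F, C0 F -> rho (translate g F) = al g (rho F).

Definition WLT_witness (R : realType) (G : compactGroupType) (A : cstarType R)
    (al : cstar_action G A) (d : nat) : Prop :=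
  exists rho : 'I_d.+1 -> (cone R G -> R[i]^o) -> A,
    (forall i, C0_star_hom (rho i) /\ equivariant al (rho i)) /\
    invertible (\sum_i rho i (tensor (@cone_id R) (fun=> 1))).

(* None stands for infinity. *)
Definition least_nat (P : nat -> Prop) : option nat :=
  if pselect (exists d, `[< P d >]) is left exP then Some (ex_minn exP)
  else None.

Definition dim_WLT (R : realType) (G : compactGroupType) (A : cstarType R)
    (al : cstar_action G A) : option nat :=
  least_nat (WLT_witness al).

Definition cuntz_rel (R : realType) (n : nat) (A : cstarType R)
    (S : 'I_n -> A) : Prop :=
  (forall i, star (S i) * S i = 1) /\ \sum_i S i * star (S i) = 1.

Definition cuntz_universal (R : realType) (n : nat) (A : cstarType R)
    (S : 'I_n -> A) : Prop :=
  cuntz_rel S /\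
  (forall (B : cstarType R) (T : 'I_n -> B), cuntz_rel T ->
     exists! phi : A -> B, unital_star_hom phi /\ forall i, phi (S i) = T i).

(* O_n is any C*-algebra with the universal property; it is determined up to
   a unique isomorphism matching the generators. *)
Record cuntzAlgebra (R : realType) (n : nat) := CuntzAlgebra {
  cuntz_sort :> cstarType R;
  cuntz_gen : 'I_n -> cuntz_sort;
  cuntz_genP : cuntz_universal cuntz_gen }.

Definition circle (R : realType) : set R[i]^o := [set z | `|z| = 1].

Section Gauge.
Context {R : realType} {n : nat} (O : cuntzAlgebra R n).

Lemma circle_conjM (z : R[i]) : @circle R z -> z^* * z = 1.
Proof.
rewrite /circle/= => z1; rewrite mulrC; transitivity (`|z| ^+ 2).
  exact/esym/(normCK z).
by rewrite z1 expr1n.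
Qed.

Lemma cuntz_rel_rotate (z : R[i]) : @circle R z ->
  cuntz_rel (fun i => z *: cuntz_gen O i).
Proof.
move=> /circle_conjM z1; have [[SS SSt] _] := cuntz_genP O; split => [i|].
  by rewrite starZ -scalerAl -scalerAr scalerA z1 scale1r SS.
rewrite -SSt; apply: eq_bigr => i _.
by rewrite starZ -scalerAl -scalerAr scalerA [z * _]mulrC z1 scale1r.
Qed.

Lemma gauge_ex (z : R[i]) (hz : @circle R z) : exists phi : O -> O,
  unital_star_hom phi /\ forall i, phi (cuntz_gen O i) = z *: cuntz_gen O i.
Proof.
have [_ /(_ _ _ (cuntz_rel_rotate hz))[phi [? _]]] := cuntz_genP O.
by exists phi.
Qed.

Definition gauge (z : R[i]) (hz : @circle R z) : O -> O :=
  sval (cid (gauge_ex hz)).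

Lemma gauge_hom (z : R[i]) (hz : @circle R z) : unital_star_hom (gauge hz).
Proof. by rewrite /gauge; case: cid => phi []. Qed.

Lemma gauge_gen (z : R[i]) (hz : @circle R z) i :
  gauge hz (cuntz_gen O i) = z *: cuntz_gen O i.
Proof. by rewrite /gauge; case: cid => phi []. Qed.

Lemma gauge_unique (z : R[i]) (hz : @circle R z) (phi : O -> O) :
  unital_star_hom phi ->
  (forall i, phi (cuntz_gen O i) = z *: cuntz_gen O i) -> phi = gauge hz.
Proof.
move=> phiH phiS.
have [_ /(_ _ _ (cuntz_rel_rotate hz))[psi [_ psiU]]] := cuntz_genP O.
by rewrite -(psiU phi)// -(psiU (gauge hz))//; split;
  [exact: gauge_hom|exact: gauge_gen].
Qed.

End Gauge.

Arguments gauge {R n} O {z} hz.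
Arguments gauge_hom {R n} O {z} hz.

Definition dyadic_roots (R : realType) (m : nat) : set R[i]^o :=
  [set z | z ^+ (2 ^ m) = 1].

Definition mu2 (R : realType) (m : nat) : Type :=
  set_type (@dyadic_roots R m).

Section Mu2.
Context {R : realType} {m : nat}.
Local Notation mu2 := (mu2 R m).

HB.instance Definition _ := Topological.on mu2.

Lemma mu2P (z : mu2) : (set_val z : R[i]) ^+ (2 ^ m) = 1.
Proof. exact: set_valP z. Qed.

Definition mu2_mk (z : R[i]) (hz : z ^+ (2 ^ m) = 1) : mu2 :=
  exist _ (z : R[i]^o) (mem_set hz).

Lemma mu2_inj (x y : mu2) : set_val x = set_val y :> R[i] -> x = y.
Proof. exact: val_inj. Qed.

Lemma mu2_one_subproof : (1 : R[i]) ^+ (2 ^ m) = 1.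
Proof. by rewrite expr1n. Qed.

Lemma mu2_mul_subproof (x y : mu2) :
  ((set_val x : R[i]) * (set_val y : R[i])) ^+ (2 ^ m) = 1.
Proof. by rewrite exprMn !mu2P mulr1. Qed.

Lemma mu2_inv_subproof (x : mu2) : (set_val x : R[i])^-1 ^+ (2 ^ m) = 1.
Proof. by rewrite exprVn mu2P invr1. Qed.

Definition mu2_one : mu2 := mu2_mk mu2_one_subproof.
Definition mu2_mul (x y : mu2) : mu2 := mu2_mk (mu2_mul_subproof x y).
Definition mu2_inv (x : mu2) : mu2 := mu2_mk (mu2_inv_subproof x).

Lemma mu2_neq0 (x : mu2) : (set_val x : R[i]) != 0.
Proof.
apply/eqP => x0; have := mu2P x; rewrite x0 expr0n expn_eq0/=.
by move/esym/eqP; rewrite oner_eq0.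
Qed.

Lemma mu2_mulA : associative mu2_mul.
Proof. by move=> x y z; apply: mu2_inj; exact: mulrA. Qed.
Lemma mu2_mul1 : left_id mu2_one mu2_mul.
Proof. by move=> x; apply: mu2_inj; exact: mul1r. Qed.
Lemma mu2_mulr1 : right_id mu2_one mu2_mul.
Proof. by move=> x; apply: mu2_inj; exact: mulr1. Qed.
Lemma mu2_mulV : left_inverse mu2_one mu2_inv mu2_mul.
Proof. by move=> x; apply: mu2_inj; exact: (mulVf (mu2_neq0 x)). Qed.
Lemma mu2_mulrV : right_inverse mu2_one mu2_inv mu2_mul.
Proof. by move=> x; apply: mu2_inj; exact: (mulfV (mu2_neq0 x)). Qed.

HB.instance Definition _ :=
  isGroup.Build mu2 mu2_mulA mu2_mul1 mu2_mulr1 mu2_mulV mu2_mulrV.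

Lemma mu2_finite : finite_set [set: mu2].
Proof.
pose p : {poly R[i]} := 'X^(2 ^ m) - 1.
have [rs prs] := closed_field_poly_normal p.
have lp : lead_coef p != 0.
  by rewrite lead_coef_eq0 -size_poly_eq0 size_XnsubC// expn_gt0.
have -> : [set: mu2] = set_val @^-1` [set x : R[i]^o | x \in rs].
  apply/seteqP; split=> // z _ /=.
  suff : root p (set_val z) by rewrite prs rootZ// root_prod_XsubC.
  by rewrite rootE !hornerE (mu2P z) subrr.
by apply: finite_preimage; [move=> x y _ _; exact: mu2_inj|exact: finite_seq].
Qed.

Lemma mu2_hausdorff : hausdorff_space mu2.
Proof.
rewrite open_hausdorff => x y xy.
have : hausdorff_space (R[i]^o : pseudoMetricNormedZmodType R[i]).
  exact: norm_hausdorff.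
rewrite open_hausdorff => /(_ (set_val x) (set_val y)) [].
  by apply: contra_neq xy => /mu2_inj.
move=> [A B] /= [Ax By] [oA oB /eqP/seteqP[AB _]].
have cval : continuous (set_val : mu2 -> R[i]^o) by exact: initial_continuous.
exists (set_val @^-1` A, set_val @^-1` B); first by rewrite !inE in Ax By *.
split=> /=; [by apply: open_comp => // z _; exact: cval..|].
by apply/eqP/seteqP; split => // z [Az Bz]; apply: (AB (set_val z)).
Qed.

Lemma mu2_compact : compact [set: mu2].
Proof. exact: finite_compact mu2_finite. Qed.

Lemma mu2_discrete (x : mu2) : nbhs x [set x].
Proof.
apply: open_nbhs_nbhs; split=> //.
rewrite -[X in open X]setCK; apply: closed_openC.
apply: (accessible_finite_set_closed.1 (hausdorff_accessible mu2_hausdorff)).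
exact: sub_finite_set (subsetT _) mu2_finite.
Qed.

Lemma mu2_near (x : mu2) (P : mu2 -> Prop) : P x -> \forall y \near x, P y.
Proof. by move=> Px; apply: filterS (mu2_discrete x) => _ ->. Qed.

Lemma mu2_mul_continuous : continuous (fun x : mu2 * mu2 => (x.1 * x.2)%g).
Proof.
move=> x A /nbhs_singleton Afx.
exists ([set x.1], [set x.2]); first by split; exact: mu2_discrete.
by move=> [y1 y2] /= [-> ->].
Qed.

Lemma mu2_inv_continuous : continuous (fun x : mu2 => (x^-1)%g).
Proof. by move=> x A /nbhs_singleton Afx; exact: mu2_near. Qed.

HB.instance Definition _ := isCompactGroup.Build mu2
  mu2_mul_continuous mu2_inv_continuous mu2_hausdorff mu2_compact.

Lemma mu2_circle (z : mu2) : @circle R (set_val z).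
Proof.
apply/eqP; rewrite -(@pexpr_eq1 _ _ (2 ^ m)) ?expn_gt0//.
by rewrite -normrX mu2P normr1.
Qed.

Context {n : nat} (O : cuntzAlgebra R n).

Let gauge_act (z : mu2) : O -> O := gauge O (mu2_circle z).

Lemma gauge_mu2_1 (a : O) : gauge_act 1%g a = a.
Proof.
suff -> : gauge_act 1%g = id by [].
apply/esym/gauge_unique => [|i]; first by split.
exact/esym/scale1r.
Qed.

Lemma gauge_mu2_M (g h : mu2) (a : O) :
  gauge_act (g * h)%g a = gauge_act g (gauge_act h a).
Proof.
suff -> : gauge_act (g * h)%g = gauge_act g \o gauge_act h by [].
have [gD gZ gM g1 gs] := gauge_hom O (mu2_circle g).
have [hD hZ hM h1 hs] := gauge_hom O (mu2_circle h).
apply/esym/gauge_unique => [|i].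
  by split=> * /=; rewrite /gauge_act ?(hD, hZ, hM, h1, hs)
    ?(gD, gZ, gM, g1, gs).
by rewrite /= /gauge_act gauge_gen gZ gauge_gen scalerA mulrC.
Qed.

Lemma gauge_mu2_continuous (a : O) (g : mu2) (e : R) : 0 < e ->
  \forall h \near g, cnorm (gauge_act h a - gauge_act g a) < e.
Proof.
move=> e0; apply: mu2_near; rewrite subrr.
suff -> : cnorm (0 : O) = 0 by [].
by rewrite -(scale0r (0 : O)) cnormZ normr0 mul0r.
Qed.

Definition gauge_mu2 : cstar_action mu2 O :=
  CStarAction (fun z => gauge_hom O (mu2_circle z))
    gauge_mu2_1 gauge_mu2_M gauge_mu2_continuous.

End Mu2.

(* Main.v *)
(* Upper bound.  Let N = 2^m and let i be a letter.  The isometries S_i^r S_d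
   with r < N and d <> i have orthogonal ranges exhausting 1 - S_i^N S_i^*N, and
   the gauge action multiplies the r-th one by g^(r+1).  A discrete Fourier
   transform in r turns them into N orthogonal projections which the action
   permutes freely, that is, into an equivariant *-homomorphism C(Z/N) -> O_n
   with unit 1 - S_i^N S_i^*N.  Two letters give two such units, whose sum is
   invertible.

   Lower bound.  If rho(t (x) 1) is invertible then y = rho(t (x) chi), with chi
   the inclusion of Z/N into the circle, is invertible, and -1 maps it to -y.
   No such y exists in O_n.  Indeed O_n acts on a Hilbert space V containing a
   copy of the full Fock space L over C^n that both S_i and S_i^* preserve up to
   finite rank, and they commute up to finite rank with the right creation
   operators R_i.  Approximate y by an odd polynomial T in the generators,
   still invertible.  Its compressions L_0 -> L_1 and L_1 -> L_0 to the even and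
   odd parts are Fredholm, of index k_0 and k_1.  From
   L_0 = C + sum_i R_i L_1 and L_1 = sum_i R_i L_0 one gets k_0 = 1 + n k_1 and
   k_1 = -1 + n k_0, so (n + 1) k_0 = 1, which is absurd.  Everything happens
   inside O_n: V is the closed span of isometries e_x in O_n with
   e_x^* e_y = delta_xy, and O_n acts by left multiplication through an
   endomorphism.  The index is computed with traces of finite-rank operators. *)

Require Import Defs.
From HB Require Import structures.
From mathcomp Require Import all_boot all_order all_algebra.
From mathcomp Require Import complex ring lra zify.
From mathcomp Require Import all_classical all_reals all_analysis.

Set Implicit Arguments.
Unset Strict Implicit.
Unset Printing Implicit Defensive.

Import Order.TTheory GRing.Theory Num.Theory.
Import numFieldNormedType.Exports.
Import Normc.

Local Open Scope classical_set_scope.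
Local Open Scope ring_scope.
Local Open Scope complex_scope.

(** The norm axioms and completeness are the only analytic input: positivity, spectra and external
    representations are avoided, and this shapes the proof. The relations do not say that the [S i]
    have orthogonal ranges; the usual argument compares positive elements, and here it is replaced
    by the fact that 1 is an extreme point of the unit ball. An orthonormal sequence permuted by
    isometries needs a starting vector; changing the family so that one isometry fixes [S i0]
    provides it, and the numbers written in base n index the orbit of that vector. Fredholm theory
    is replaced by idempotents and inverses modulo finite rank; an index is an integer because the
    defects can be traded for finite-rank idempotents. The odd polynomial comes from mapping O_n to
    two copies at once, [S i] going to [(G i, - G i)]: half the difference of the coordinates is the
    odd part. In the lower bound n >= 2 supplies two letters for the new family and lets n - 1 be
    cancelled in the index equations. *)

Definition mklinear (K : fieldType) (U W : lmodType K) (f : U -> W)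
    (lf : linear f) : {linear U -> W} :=
  HB.pack f (GRing.isLinear.Build _ _ _ _ f lf).

(** * Endomorphisms and the trace of finite-rank ones *)

Section Endomorphisms.
Variables (K : fieldType) (V : lmodType K).

Definition endo_pred : {pred V -> V} := fun f => `[<linear f>].

Lemma endo_zmod_closed : zmod_closed endo_pred.
Proof.
split; first by apply/asboolP => a u v; rewrite /= /GRing.zero /= scaler0 addr0.
move=> f g /asboolP lf /asboolP lg; apply/asboolP => a u v.
rewrite !fctE /= lf lg scalerDr scalerN opprD.
by rewrite -!addrA; congr (_ + _); rewrite addrCA.
Qed.

HB.instance Definition _ := GRing.isZmodClosed.Build (V -> V) endo_pred
  endo_zmod_closed.

(** Bundled so that linear maps form a ring under composition and index computations become ring
    identities. [V] may be zero, so 1 = 0 has to be allowed in this ring. *)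
Record endo := Endo { endo_fun :> V -> V; _ : endo_fun \in endo_pred }.

HB.instance Definition _ := [isSub for endo_fun].
HB.instance Definition _ := [Choice of endo by <:].
HB.instance Definition _ := [SubChoice_isSubZmodule of endo by <:].

Lemma endo_linear (f : endo) : linear f.
Proof. by case: f => f /= /asboolP. Qed.

HB.instance Definition _ (f : endo) :=
  GRing.isLinear.Build K V V *:%R (endo_fun f) (endo_linear f).

Definition mkendo (f : V -> V) (lf : linear f) : endo := Endo (asboolT lf).

Lemma endoP (f g : endo) : f =1 g <-> f = g.
Proof. by split=> [fg|->//]; apply/val_inj/funext. Qed.

Lemma endoD (f g : endo) v : (f + g) v = f v + g v. Proof. by []. Qed.
Lemma endoN (f : endo) v : (- f) v = - f v. Proof. by []. Qed.
Lemma endo0 v : (0 : endo) v = 0. Proof. by []. Qed.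

Lemma endo_id_linear : linear (@id V). Proof. by []. Qed.
Lemma endo_comp_linear (f g : endo) : linear (f \o g).
Proof. by move=> a u v; rewrite /= !linearP. Qed.

Definition endo_one := mkendo endo_id_linear.
Definition endo_mul f g := mkendo (endo_comp_linear f g).

Fact endo_mulA : associative endo_mul.
Proof. by move=> f g h; apply/endoP. Qed.
Fact endo_mul1 : left_id endo_one endo_mul.
Proof. by move=> f; apply/endoP. Qed.
Fact endo_mulr1 : right_id endo_one endo_mul.
Proof. by move=> f; apply/endoP. Qed.
Fact endo_mulDl : left_distributive endo_mul +%R.
Proof. by move=> f g h; apply/endoP. Qed.
Fact endo_mulDr : right_distributive endo_mul +%R.
Proof. by move=> f g h; apply/endoP => v; exact: linearD. Qed.

HB.instance Definition _ := GRing.Zmodule_isPzRing.Build endo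
  endo_mulA endo_mul1 endo_mulr1 endo_mulDl endo_mulDr.

Lemma endoM (f g : endo) v : (f * g) v = f (g v). Proof. by []. Qed.

Lemma endo_sum I (r : seq I) (P : pred I) (F : I -> endo) v :
  (\sum_(i <- r | P i) F i) v = \sum_(i <- r | P i) F i v.
Proof. by elim/big_rec2: _ => // i _ f _ <-. Qed.

(** A factorization of [h] through K^s, with the trace of the reverse composite K^s -> K^s. No basis
    of [V] is involved; independence of the factorization is [has_trace_uniq]. *)
Definition has_trace (h : endo) (t : K) := exists s (k : {linear V -> 'rV[K]_s})
  (x : 'I_s -> V), (forall v, h v = \sum_j k v 0 j *: x j) /\
  t = \sum_j k (x j) 0 j.

Definition finite_rank (h : endo) := exists t, has_trace h t.

(** In a full-rank factorization N = C R, the relation C R C R = 0 forces R C = 0, and tr N = tr (R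
    C). *)
Lemma mxtrace_sqr0 m (N : 'M[K]_m) : N *m N = 0 -> \tr N = 0.
Proof.
rewrite -(mulmx_base N) => N0.
suff RC0 : row_base N *m col_base N = 0 by rewrite mxtrace_mulC RC0 mxtrace0.
apply: (row_full_inj (col_base_full N)); apply: (row_free_inj (row_base_free N)).
by rewrite mulmx0 mul0mx -[RHS]N0 !mulmxA.
Qed.

Lemma has_traceD g h t u :
  has_trace g t -> has_trace h u -> has_trace (g + h) (t + u).
Proof.
move=> [s [k [x [hk ->]]]] [s' [k' [x' [hk' ->]]]].
pose kk v := row_mx (k v) (k' v).
pose xx (a : 'I_(s + s')) :=
  match fintype.split a with inl j => x j | inr j => x' j end.
have xl j : xx (lshift s' j) = x j by rewrite /xx (unsplitK (inl j)).
have xr j : xx (rshift s j) = x' j by rewrite /xx (unsplitK (inr j)).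
have kk_lin : linear kk.
  by move=> a u' v; rewrite /kk !linearP /= scale_row_mx add_row_mx.
pose kL := mklinear kk_lin.
exists (s + s')%N, kL, xx; split => [v|]; rewrite big_split_ord /=.
  rewrite -[LHS]/(g v + h v) hk hk'; congr (_ + _); apply: eq_bigr => j _.
    by rewrite xl /kk row_mxEl.
  by rewrite xr /kk row_mxEr.
congr (_ + _); apply: eq_bigr => j _; first by rewrite xl /kk row_mxEl.
by rewrite xr /kk row_mxEr.
Qed.

Lemma has_traceN h t : has_trace h t -> has_trace (- h) (- t).
Proof.
move=> [s [k [x [hk ->]]]]; exists s, k, (fun j => - x j); split.
  by move=> v; rewrite endoN hk -sumrN; apply: eq_bigr => j _; rewrite scalerN.
by rewrite -sumrN; apply: eq_bigr => j _; rewrite linearN mxE.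
Qed.

(** A factorization of 0 may have a nonzero composite K^s -> K^s, but that matrix squares to
    zero. *)
Lemma has_trace0_eq t : has_trace 0 t -> t = 0.
Proof.
move=> [s [k [x [hk ->]]]].
pose N := \matrix_(a, b) k (x a) 0 b.
rewrite -[LHS]/(\sum_j _) -[RHS](@mxtrace_sqr0 _ N).
  by apply: eq_bigr => j _; rewrite mxE.
apply/matrixP => a c; rewrite !mxE.
transitivity (k (\sum_b k (x a) 0 b *: x b) 0 c).
  by rewrite linear_sum summxE; apply: eq_bigr => b _; rewrite !mxE linearZ mxE.
by rewrite -hk endo0 linear0 mxE.
Qed.

Lemma has_trace_uniq h t u : has_trace h t -> has_trace h u -> t = u.
Proof.
move=> ht /has_traceN/(has_traceD ht); rewrite subrr => /has_trace0_eq/eqP.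
by rewrite subr_eq0 => /eqP.
Qed.

Lemma has_trace0 : has_trace 0 0.
Proof.
exists 0%N, (\0%R : {linear V -> 'rV[K]_0}), (fun=> 0).
by split=> [v|]; rewrite big_ord0.
Qed.

(** Moving [a] onto the vectors or onto the functionals of a factorization of [h] produces the same
    diagonal sum. *)
Lemma has_traceC h t a : has_trace h t ->
  exists u, has_trace (a * h) u /\ has_trace (h * a) u.
Proof.
move=> [s [k [x [hk _]]]]; exists (\sum_j k (a (x j)) 0 j).
have ka_lin : linear (k \o a) by move=> c u v; rewrite /= !linearP.
split.
  exists s, k, (a \o x); split=> // v.
  by rewrite endoM hk linear_sum; apply: eq_bigr => j _; rewrite linearZ.
exists s, (mklinear ka_lin), x.
by split=> // v; rewrite endoM hk.
Qed.

Lemma finite_rankD g h : finite_rank g -> finite_rank h -> finite_rank (g + h).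
Proof. by move=> [t gt] [u hu]; exists (t + u); exact: has_traceD. Qed.

Lemma finite_rankN h : finite_rank h -> finite_rank (- h).
Proof. by move=> [t ht]; exists (- t); exact: has_traceN. Qed.

Lemma finite_rankB g h : finite_rank g -> finite_rank h -> finite_rank (g - h).
Proof. by move=> fg /finite_rankN; exact: finite_rankD. Qed.

Lemma finite_rank0 : finite_rank 0.
Proof. by exists 0; exact: has_trace0. Qed.

Lemma finite_rankMl a h : finite_rank h -> finite_rank (a * h).
Proof. by move=> [t /has_traceC -/(_ a)[u [au _]]]; exists u. Qed.

Lemma finite_rankMr a h : finite_rank h -> finite_rank (h * a).
Proof. by move=> [t /has_traceC -/(_ a)[u [_ ua]]]; exists u. Qed.

Lemma finite_rank_sum (I : Type) (r : seq I) (F : I -> endo) :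
  (forall i, finite_rank (F i)) -> finite_rank (\sum_(i <- r) F i).
Proof.
by move=> fF; elim/big_rec: _ => [|i h _ fh];
  [exact: finite_rank0|exact: finite_rankD].
Qed.

(* The value at operators of infinite rank is 0. *)
Definition ftrace (h : endo) : K :=
  if pselect (finite_rank h) is left p then sval (cid p) else 0.

Lemma ftraceE h t : has_trace h t -> ftrace h = t.
Proof.
move=> ht; rewrite /ftrace; case: pselect => [p|[]]; last by exists t.
by case: cid => u hu /=; exact: has_trace_uniq hu ht.
Qed.

Lemma ftraceD g h : finite_rank g -> finite_rank h ->
  ftrace (g + h) = ftrace g + ftrace h.
Proof.
move=> [t gt] [u hu]; rewrite (ftraceE gt) (ftraceE hu).
exact/ftraceE/has_traceD.
Qed.

Lemma ftraceN h : finite_rank h -> ftrace (- h) = - ftrace h.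
Proof. by move=> [t ht]; rewrite (ftraceE ht); exact/ftraceE/has_traceN. Qed.

Lemma ftraceB g h : finite_rank g -> finite_rank h ->
  ftrace (g - h) = ftrace g - ftrace h.
Proof.
by move=> fg fh; rewrite ftraceD ?ftraceN//; exact: finite_rankN.
Qed.

Lemma ftraceC a h : finite_rank h -> ftrace (a * h) = ftrace (h * a).
Proof.
by move=> [t /has_traceC -/(_ a)[u [/ftraceE-> /ftraceE->]]].
Qed.

Lemma ftrace_sum (I : Type) (r : seq I) (F : I -> endo) :
  (forall i, finite_rank (F i)) ->
  ftrace (\sum_(i <- r) F i) = \sum_(i <- r) ftrace (F i).
Proof.
move=> fF; elim: r => [|i r IH]; first by rewrite !big_nil (ftraceE has_trace0).
by rewrite !big_cons ftraceD ?IH//; exact: finite_rank_sum.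
Qed.

Lemma row_span_closed s (U : 'rV[K]_s -> Prop) m (B : 'M[K]_(m, s)) :
  U 0 -> (forall a u v, U u -> U v -> U (a *: u + v)) ->
  (forall i, U (row i B)) -> forall u, (u <= B)%MS -> U u.
Proof.
move=> U0 UP UB u /submxP[D ->]; rewrite mulmx_sum_row.
elim/big_rec: _ => // i v _ Uv; exact: UP.
Qed.

(** The subspace comes without generators; a matrix of maximal rank with rows in [U] must span it,
    since adjoining a missing vector would raise the rank. *)
Lemma subspace_mx s (U : 'rV[K]_s -> Prop) :
  U 0 -> (forall a u v, U u -> U v -> U (a *: u + v)) ->
  exists B : 'M[K]_s, forall u, U u <-> (u <= B)%MS.
Proof.
move=> U0 UP.
pose Q r := exists2 B : 'M[K]_s, (forall i, U (row i B)) & \rank B = r.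
have exQ : exists r, `[< Q r >].
  exists 0%N; apply/asboolP; exists 0; last exact: mxrank0.
  by move=> i; rewrite row0.
have ubQ r : `[< Q r >] -> (r <= s)%N by move=> /asboolP[B _ <-]; exact: rank_leq_row.
case: (ex_maxnP exQ ubQ) => r /asboolP[B UB rB] rmax.
exists B => u; split; last exact: row_span_closed.
move=> Uu; suff : (B + u <= B)%MS by rewrite addsmx_sub => /andP[].
rewrite -mxrank_leqif_sup ?addsmxSl// eqn_leq mxrankS ?addsmxSl//= rB.
apply: rmax; apply/asboolP; exists (B + u)%MS => // i.
have /sub_addsmxP[[D1 D2] /= ->] : (row i (B + u)%MS <= B + u)%MS by exact: row_sub.
have UD1 : U (D1 *m B) by apply: (row_span_closed U0 UP UB); exact: submxMl.
rewrite addrC [D2]mx11_scalar mul_scalar_mx; exact: UP.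
Qed.

(* The complement of a kernel is spanned by finitely many vectors, and e
   projects onto it along the kernel; its trace is a dimension. *)
Lemma finite_rank_proj h : finite_rank h -> exists e r,
  [/\ has_trace e r%:R, h * e = h & forall a, h * a = 0 -> e * a = 0].
Proof.
move=> [_ [s [k [x [hk _]]]]].
pose I (z : 'rV_s) := \sum_j z 0 j *: x j.
have [B1 B1P] : exists B : 'M[K]_s, forall u, I u = 0 <-> (u <= B)%MS.
  apply: subspace_mx.
    by rewrite /I big1// => j _; rewrite mxE scale0r.
  move=> a u v Iu Iv; rewrite -[RHS](scaler0 V a) -[in RHS]Iu -[LHS]addr0.
  rewrite -[in LHS]oppr0 -[in LHS]Iv /I; apply/eqP; rewrite subr_eq; apply/eqP.
  rewrite scaler_sumr -big_split/=; apply: eq_bigr => j _.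
  by rewrite !mxE scalerDl scalerA.
(* Dividing by the relations between the [x j] makes the kernel of [k1] exactly that of [h]. *)
pose k1 v := k v *m cokermx B1.
have k1_lin : linear k1.
  by move=> a u v; rewrite /k1 linearP mulmxDl scalemxAl.
have k1P v : k1 v = 0 <-> h v = 0.
  rewrite hk -[\sum_j _]/(I (k v)) B1P submxE.
  by split=> /eqP.
have [B2 B2P] : exists B : 'M[K]_s, forall u, (exists v, u = k1 v) <-> (u <= B)%MS.
  apply: subspace_mx; first by exists 0; rewrite /k1 linear0 mul0mx.
  by move=> a _ _ [u ->] [v ->]; exists (a *: u + v); rewrite k1_lin.
pose M := row_base B2; pose ka v := k1 v *m pinvmx M.
have kaM v : ka v *m M = k1 v.
  by rewrite /ka mulmxKpV // eq_row_base; apply/B2P; exists v.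
have ka_lin : linear ka.
  by move=> a u v; rewrite /ka k1_lin mulmxDl -scalemxAl.
pose kL := mklinear ka_lin.
(* Preimages of a basis of the image of [k1]; they are dual to the coordinates [ka] and span the
   complement of the kernel. *)
have /choice[l lP] : forall i, exists v, row i M = k1 v.
  by move=> i; apply/B2P; rewrite -(eq_row_base B2) row_sub.
have kal i : ka (l i) = delta_mx 0 i.
  by rewrite /ka -lP -row_mul mulmxVp ?row_base_free// row1.
pose ef v := \sum_j kL v 0 j *: l j.
have ef_lin : linear ef.
  move=> a u v; rewrite /ef scaler_sumr -big_split/=; apply: eq_bigr => j _.
  by rewrite ka_lin !mxE scalerDl scalerA.
have kaef v : ka (ef v) = ka v.
  rewrite -[LHS]/(kL (\sum_j kL v 0 j *: l j)) linear_sum [RHS]row_sum_delta.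
  by apply: eq_bigr => j _; rewrite linearZ; congr (_ *: _); exact: kal.
exists (mkendo ef_lin), (\rank B2); split.
- exists _, kL, l; split=> //.
  under eq_bigr do rewrite /= kal mxE !eqxx.
  by rewrite sumr_const card_ord.
- apply/endoP => v; rewrite endoM; apply/eqP; rewrite -subr_eq0 -linearB.
  apply/eqP/k1P; rewrite -kaM -[ka _]/(kL _) linearB/= kaef subrr.
  by rewrite mul0mx.
- move=> a /endoP ha; apply/endoP => v; rewrite endoM.
  have /k1P k10 : h (a v) = 0 by have := ha v.
  rewrite /= /ef /= big1// => j _.
  by rewrite /ka k10 mul0mx mxE scale0r.
Qed.

End Endomorphisms.

(** * Index of almost invertible operators *)

Section Index.
Variables (K : numFieldType) (V : lmodType K).
Implicit Types P Q f g : endo V.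

(* f is viewed as an operator P V -> Q V with parametrix g. *)
Definition fredholm_index P Q f g : K := ftrace (P - g * f) - ftrace (Q - f * g).

(** The defects change by [(g' - g) * f' + g * (f' - f)] and [f' * (g' - g) + (f' - f) * g], whose
    traces agree by cyclicity. *)
Lemma index_perturb P Q f g f' g' :
  finite_rank (P - g * f) -> finite_rank (Q - f * g) ->
  finite_rank (f' - f) -> finite_rank (g' - g) ->
  [/\ finite_rank (P - g' * f'), finite_rank (Q - f' * g') &
      fredholm_index P Q f' g' = fredholm_index P Q f g].
Proof.
move=> frP frQ frf frg.
have eP : P - g' * f' = P - g * f - ((g' - g) * f' + g * (f' - f)).
  by rewrite mulrBl mulrBr addrA subrK opprB addrA subrK.
have eQ : Q - f' * g' = Q - f * g - (f' * (g' - g) + (f' - f) * g).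
  by rewrite mulrBl mulrBr addrA subrK opprB addrA subrK.
have fr1 : finite_rank ((g' - g) * f') by exact: finite_rankMr.
have fr2 : finite_rank (g * (f' - f)) by exact: finite_rankMl.
have fr3 : finite_rank (f' * (g' - g)) by exact: finite_rankMl.
have fr4 : finite_rank ((f' - f) * g) by exact: finite_rankMr.
have frA := finite_rankD fr1 fr2; have frB := finite_rankD fr3 fr4.
rewrite /fredholm_index eP eQ; split; [exact: finite_rankB..|].
rewrite (ftraceB frP frA) (ftraceB frQ frB) (ftraceD fr1 fr2) (ftraceD fr3 fr4).
rewrite (ftraceC f') ?(ftraceC g)//.
by rewrite opprB addrA subrK.
Qed.

(** Since [h * (1 - P) = 0], the projection [e] along the kernel of [h] satisfies [e * P = e];
    replacing it by [P * e] moves it into the corner without changing the trace. *)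
Lemma corner_proj P h :
  P * P = P -> P * h = h -> h * P = h -> finite_rank h ->
  exists e r, [/\ has_trace e r%:R, e * P = e, P * e = e, h * e = h &
    forall a, h * a = 0 -> e * a = 0].
Proof.
move=> PP Ph hP /finite_rank_proj[e [r [te he eh]]].
have eP : e * P = e.
  apply/esym/eqP; rewrite -subr_eq0 -[X in X - _]mulr1 -mulrBr.
  by apply/eqP/eh; rewrite mulrBr mulr1 hP subrr.
exists (P * e), r; split.
- have [u [tu]] := has_traceC P te; rewrite eP => /(has_trace_uniq te) ->.
  exact: tu.
- by rewrite -mulrA eP.
- by rewrite mulrA PP.
- by rewrite mulrA hP.
- by move=> a /eh ea; rewrite -mulrA ea mulr0.
Qed.

(** On the kernels of the two defects, [f] and [g] are mutually inverse. Cutting them down to these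
    kernels is a finite-rank change, after which the defects are the idempotents [e] and [e'], whose
    traces are natural numbers. *)
Lemma index_int P Q f g : P * P = P -> Q * Q = Q ->
  Q * f = f -> f * P = f -> P * g = g -> g * Q = g ->
  finite_rank (P - g * f) -> finite_rank (Q - f * g) ->
  exists r s, fredholm_index P Q f g = r%:R - s%:R.
Proof.
move=> PP QQ Qf fP Pg gQ frP frQ.
set h := P - g * f; set h' := Q - f * g.
have hP : h * P = h by rewrite mulrBl PP -mulrA fP.
have Ph : P * h = h by rewrite mulrBr PP mulrA Pg.
have hQ : h' * Q = h' by rewrite mulrBl QQ -mulrA gQ.
have Qh : Q * h' = h' by rewrite mulrBr QQ mulrA Qf.
have [e [r [te eP Pe he eh]]] := corner_proj PP Ph hP frP.
have [e' [s [te' eQ Qe he' eh']]] := corner_proj QQ Qh hQ frQ.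
exists r, s.
have fe : finite_rank (f * (P - e) - f).
  rewrite mulrBr fP addrC addKr; apply: finite_rankN; apply: finite_rankMl.
  by exists r%:R.
have ge : finite_rank (g * (Q - e') - g).
  rewrite mulrBr gQ addrC addKr; apply: finite_rankN; apply: finite_rankMl.
  by exists s%:R.
have [_ _ <-] := index_perturb frP frQ fe ge.
(* These two commutations say that [f] and [g] exchange the kernels of [h] and [h']. *)
have hf : h' * f = f * h.
  by rewrite /h /h' mulrBl mulrBr Qf fP mulrA.
have hg : h * g = g * h'.
  by rewrite /h /h' mulrBl mulrBr Pg gQ mulrA.
have e'f : e' * (f * (P - e)) = 0.
  by apply: eh'; rewrite mulrA hf -mulrA mulrBr hP he subrr mulr0.
have eg : e * (g * (Q - e')) = 0.
  by apply: eh; rewrite mulrA hg -mulrA mulrBr hQ he' subrr mulr0.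
have gf : g * (Q - e') * (f * (P - e)) = P - e.
  rewrite -mulrA mulrBl e'f subr0 [Q * _]mulrA Qf mulrA.
  have -> : g * f = P - h by rewrite subKr.
  by rewrite mulrBl !mulrBr PP hP Pe he subrr subr0.
have fg : f * (P - e) * (g * (Q - e')) = Q - e'.
  rewrite -mulrA mulrBl eg subr0 [P * _]mulrA Pg mulrA.
  have -> : f * g = Q - h' by rewrite subKr.
  by rewrite mulrBl !mulrBr QQ hQ Qe he' subrr subr0.
by rewrite /fredholm_index gf fg !subKr (ftraceE te) (ftraceE te').
Qed.

End Index.

(** * Index equations for a graded space that contains n shifted copies of itself *)

Section SelfSimilar.
Variables (K : numFieldType) (V : lmodType K) (n : nat).
Variables (P : bool -> endo V) (Om : endo V) (R R' : 'I_n -> endo V).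

Let Omb d : endo V := if d then 0 else Om.

Hypothesis P_idem : forall d, P d * P d = P d.
Hypothesis R'R : forall d i j, R' i * R j * P d = if i == j then P d else 0.
Hypothesis PR : forall d i, P (~~ d) * R i = R i * P d.
Hypothesis Om_trace : has_trace Om 1.
Hypothesis P_dec : forall d,
  P d = (if d then 0 else Om) + \sum_i R i * P (~~ d) * R' i.

(** The direct sum of n copies of [h], carried by the [R i] to the opposite parity. *)
Definition inflate (h : endo V) := \sum_i R i * h * R' i.

Lemma inflateB g h : inflate (g - h) = inflate g - inflate h.
Proof.
rewrite /inflate -sumrB; apply: eq_bigr => i _.
by rewrite mulrBr mulrBl.
Qed.

Lemma inflateM d g h : P d * h = h -> inflate g * inflate h = inflate (g * h).
Proof.
move=> Ph.
have RRh i j : R' i * R j * h = if i == j then h else 0.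
  by rewrite -Ph mulrA R'R; case: ifP => // _; rewrite mul0r.
rewrite /inflate big_distrl; apply: eq_bigr => i _ /=.
rewrite big_distrr (bigD1 i)//= [X in _ + X]big1 ?addr0; last first.
  move=> j ji; rewrite -!mulrA [R' i * _]mulrA [_ * (h * _)]mulrA RRh.
  by rewrite eq_sym (negbTE ji) mul0r !mulr0.
by rewrite -!mulrA [R' i * _]mulrA [_ * (h * _)]mulrA RRh eqxx.
Qed.

Lemma finite_rank_inflate h : finite_rank h -> finite_rank (inflate h).
Proof.
by move=> fh; apply: finite_rank_sum => i; exact/finite_rankMr/finite_rankMl.
Qed.

Lemma ftrace_inflate d h : P d * h = h -> finite_rank h ->
  ftrace (inflate h) = n%:R * ftrace h.
Proof.
move=> Ph fh; rewrite ftrace_sum => [|i]; last exact/finite_rankMr/finite_rankMl.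
have RRh i : R' i * (R i * h) = h by rewrite mulrA -Ph mulrA R'R eqxx.
rewrite (eq_bigr (fun=> ftrace h)) ?sumr_const ?card_ord ?mulr_natl// => i _.
by rewrite -[in RHS](RRh i) [in RHS]ftraceC//; exact: finite_rankMl.
Qed.

Let comp (T : endo V) d := P (~~ d) * T * P d.

(** Multiplying the defect [T * P d - P (~~ d) * T] by [P d * T'] on the left and [P d] on the right
    gives the operator in question. *)
Lemma comp_inv T T' d : T' * T = 1 ->
  (forall d, finite_rank (T * P d - P (~~ d) * T)) ->
  finite_rank (P d - comp T' (~~ d) * comp T d).
Proof.
move=> T'T /(_ d) /(finite_rankMl (P d * T')) /(finite_rankMr (P d)).
rewrite mulrBr mulrBl /comp negbK; congr (finite_rank (_ - _)).
  by rewrite -!mulrA [T' * _]mulrA T'T mul1r !P_idem.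
by rewrite !mulrA -[_ * P (~~ d) * P (~~ d)]mulrA P_idem.
Qed.

(** Expand the right factor [P d] by [P_dec] and move [T] past each [R i]; the vacuum term has rank
    at most one. *)
Lemma comp_inflate T d :
  (forall i, finite_rank (T * R i - R i * T)) ->
  finite_rank (inflate (comp T (~~ d)) - comp T d).
Proof.
move=> TR.
have -> : comp T d = P (~~ d) * T * Omb d +
    \sum_i P (~~ d) * T * R i * P (~~ d) * R' i.
  rewrite /comp [X in _ * X]P_dec mulrDr mulr_sumr; congr (_ + _).
  by apply: eq_bigr => i _; rewrite !mulrA.
rewrite opprD addrCA addrC; apply: finite_rankB; last first.
  apply: finite_rankMl; rewrite /Omb; case: d; first exact: finite_rank0.
  by exists 1.
rewrite /inflate -sumrB; apply: finite_rank_sum => i.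
rewrite /comp negbK !mulrA -PR -!mulrBl -!(mulrA (P (~~ d))) -mulrBr.
apply: finite_rankMr; apply: finite_rankMr; apply: finite_rankMl.
by rewrite -opprB; exact: finite_rankN.
Qed.

Variables T T' : endo V.
Hypothesis TT' : T * T' = 1.
Hypothesis T'T : T' * T = 1.
Hypothesis TP : forall d, finite_rank (T * P d - P (~~ d) * T).
Hypothesis TR : forall i, finite_rank (T * R i - R i * T).

Let T'P d : finite_rank (T' * P d - P (~~ d) * T').
Proof.
have := finite_rankMr T' (finite_rankMl T' (finite_rankN (TP (~~ d)))).
rewrite opprB negbK mulrBr mulrBl; congr (finite_rank (_ - _)).
  by rewrite -!mulrA TT' mulr1.
by rewrite mulrA T'T mul1r.
Qed.

Let T'R i : finite_rank (T' * R i - R i * T').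
Proof.
have := finite_rankMr T' (finite_rankMl T' (finite_rankN (TR i))).
rewrite opprB mulrBr mulrBl; congr (finite_rank (_ - _)).
  by rewrite -!mulrA TT' mulr1.
by rewrite mulrA T'T mul1r.
Qed.

Let gf d : finite_rank (P d - comp T' (~~ d) * comp T d).
Proof. exact: comp_inv. Qed.

Let fg d : finite_rank (P (~~ d) - comp T d * comp T' (~~ d)).
Proof. by have := comp_inv (~~ d) TT' T'P; rewrite negbK. Qed.

Let I d := fredholm_index (P d) (P (~~ d)) (comp T d) (comp T' (~~ d)).

(** Both blocks may be replaced by n copies of the blocks of opposite parity. Their defects are n
    copies of the old defects plus whatever vacuum the copies do not reach, in the source and in the
    target. *)
Lemma index_rec d : I d = ftrace (Omb d) - ftrace (Omb (~~ d)) + n%:R * I (~~ d).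
Proof.
have Pc S e : P (~~ e) * comp S e = comp S e by rewrite /comp !mulrA P_idem.
rewrite {1}/I.
have [_ _ <-] := index_perturb (gf d) (fg d) (comp_inflate d TR)
                   (comp_inflate (~~ d) T'R).
rewrite !negbK.
have fOm e : finite_rank (Omb e).
  by case: e => /=; [exact: finite_rank0|exists 1].
have step e h : P e * h = h -> finite_rank (P e - h) ->
    ftrace (P (~~ e) - inflate h) =
    ftrace (Omb (~~ e)) + n%:R * ftrace (P e - h).
  move=> Ph fPh.
  have -> : P (~~ e) - inflate h = Omb (~~ e) + inflate (P e - h).
    by rewrite inflateB addrA [P (~~ e)]P_dec negbK.
  rewrite ftraceD; [|exact: fOm|exact: finite_rank_inflate].
  by rewrite (@ftrace_inflate e)// mulrBr P_idem Ph.
rewrite /fredholm_index (inflateM (d := d)); last by rewrite -[X in P X]negbK Pc.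
rewrite (inflateM (d := ~~ d)); last by rewrite Pc.
have PcT S : P d * comp S (~~ d) = comp S (~~ d).
  by rewrite -[X in P X * _]negbK Pc.
rewrite -[X in P X - _]negbK (step (~~ d)); last 2 first.
- by rewrite mulrA Pc.
- by have := gf (~~ d); rewrite negbK.
rewrite (step d); last 2 first.
- by rewrite mulrA PcT.
- by have := fg (~~ d); rewrite negbK.
by rewrite /I /fredholm_index !negbK mulrBr opprD addrACA.
Qed.

Lemma no_self_similar_inverse : (1 < n)%N -> False.
Proof.
move=> n1.
have [r [s Irs]] : exists r s, I false = r%:R - s%:R.
  apply: index_int (gf false) (fg false); rewrite ?P_idem//.
  - by rewrite /comp !mulrA P_idem.
  - by rewrite /comp -!mulrA P_idem.
  - by rewrite /comp !mulrA P_idem.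
  - by rewrite /comp -!mulrA P_idem.
have := index_rec false; have := index_rec true.
rewrite /= (ftraceE Om_trace) (ftraceE (has_trace0 V)) Irs => -> /eqP.
rewrite eq_sym -subr_eq0 => /eqP E.
(* The two recursions combine, up to sign, to (n - 1) ((n + 1) (r - s) - 1) = 0, and n - 1 is
   cancelled. *)
have n1K : n%:R - 1 != 0 :> K by rewrite subr_eq0 (eqr_nat K n 1) gtn_eqF.
have : n.+1%:R * (r%:R - s%:R) = 1 :> K.
  apply: (mulfI n1K); apply/eqP; rewrite -subr_eq0 -[X in _ == X]E; apply/eqP.
  by rewrite -natr1; ring.
(* Back in the natural numbers: (n + 1) r = (n + 1) s + 1, so n + 1 divides 1. *)
move=> /eqP; rewrite mulrBr subr_eq -!natrM addrC natr1 eqr_nat => /eqP rs.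
have := dvdn_mulr r (dvdnn n.+1); rewrite rs -[(_ * s).+1]addn1 dvdn_addr ?dvdn_mulr//.
by rewrite dvdn1; case: n n1.
Qed.

End SelfSimilar.

(** * C*-algebras: products, subalgebras, Neumann series *)

Section CStarNorm.
Variables (R : realType) (A : cstarType R).
Implicit Types x y : A.

Lemma cnorm0 : cnorm (0 : A) = 0.
Proof. by rewrite -(scale0r (0 : A)) cnormZ normr0 mul0r. Qed.

Lemma cnormN x : cnorm (- x) = cnorm x.
Proof. by rewrite -scaleN1r cnormZ normrN1 mul1r. Qed.

Lemma cdistC x y : cnorm (x - y) = cnorm (y - x).
Proof. by rewrite -cnormN opprB. Qed.

Lemma cnorm_dist x y z : cnorm (x - z) <= cnorm (x - y) + cnorm (y - z).
Proof. by rewrite -[x - z](subrKA y) cnormD_le. Qed.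

Lemma star0 : star (0 : A) = 0.
Proof. by apply: (addrI (star 0)); rewrite -starD !addr0. Qed.

Lemma starN x : star (- x) = - star x.
Proof. by apply: (addrI (star x)); rewrite -starD !subrr star0. Qed.

Lemma starB x y : star (x - y) = star x - star y.
Proof. by rewrite starD starN. Qed.

Lemma star_sum I (r : seq I) (P : pred I) (F : I -> A) :
  star (\sum_(i <- r | P i) F i) = \sum_(i <- r | P i) star (F i).
Proof. exact: (big_morph _ starD star0). Qed.

Lemma star1 : star (1 : A) = 1.
Proof. by rewrite -[RHS]starK -[X in _ = star X]mulr1 starM starK mulr1. Qed.

Lemma cnorm_star x : cnorm (star x) = cnorm x.
Proof.
suff le y : cnorm y <= cnorm (star y).
  by apply/eqP; rewrite eq_le le -{2}[x]starK le.
have [y0|] := eqVneq (cnorm y) 0; first by rewrite y0 cnorm_ge0.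
rewrite neq_lt ltNge cnorm_ge0/= => y0.
by rewrite -(ler_pM2r y0) -expr2 -cnorm_starM cnormM_le.
Qed.

Lemma cnorm1 : cnorm (1 : A) = 1.
Proof.
have /eqP : cnorm (1 : A) = cnorm (1 : A) ^+ 2.
  by rewrite -cnorm_starM star1 mulr1.
rewrite expr2 -subr_eq0 -{1}[cnorm _]mulr1 -mulrBr mulf_eq0 => /orP[/eqP|].
  by move=> /cnorm_eq0/eqP; rewrite oner_eq0.
by rewrite subr_eq0 => /eqP.
Qed.

Lemma cnorm_expn x k : cnorm (x ^+ k) <= cnorm x ^+ k.
Proof.
elim: k => [|k IH]; first by rewrite !expr0 cnorm1.
rewrite !exprS; apply: le_trans (cnormM_le _ _) _.
by rewrite ler_wpM2l ?cnorm_ge0.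
Qed.

Lemma cnorm_small_eq0 x : (forall e, 0 < e -> cnorm x < e) -> x = 0.
Proof.
move=> xe; apply: cnorm_eq0; apply/eqP; rewrite eq_le cnorm_ge0 andbT.
by apply/ler_addgt0Pl => e e0; rewrite addr0 ltW ?xe.
Qed.

End CStarNorm.

(** * Neumann series and openness of the set of invertible elements *)

Section Neumann.
Variables (R : realType) (A : cstarType R).
Implicit Types x y : A.

Lemma geometric_small (q e : R) : 0 <= q -> q < 1 -> 0 < e ->
  exists N, forall i, (N <= i)%N -> q ^+ i < e.
Proof.
move=> q0 q1 e0.
have /cvgrPdist_lt/(_ _ e0)[N _ NP] : (GRing.exp q) @ \oo --> (0 : R).
  by apply: cvg_expr; rewrite ger0_norm.
exists N => i /NP; rewrite /= sub0r normrN ger0_norm//; exact: exprn_ge0.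
Qed.

Lemma neumann_inverse (z : A) : cnorm z < 1 -> invertible (1 - z).
Proof.
move=> z1; pose s N := \sum_(k < N) z ^+ k.
have z0 := cnorm_ge0 z.
have sz N : (1 - z) * s N = 1 - z ^+ N.
  by rewrite -[RHS]opprB (subrX1 z N) -mulNr opprB.
have zs N : s N * (1 - z) = 1 - z ^+ N.
  rewrite -sz /s mulr_suml mulr_sumr; apply: eq_bigr => k _.
  by rewrite mulrBl mulrBr mul1r mulr1 -exprS -exprSr.
have q0 : 0 < 1 - cnorm z by rewrite subr_gt0.
have sB i j : (i <= j)%N -> cnorm (s j - s i) <= cnorm z ^+ i / (1 - cnorm z).
  move=> ij; rewrite ler_pdivlMr//.
  (* The factor [1 - cnorm z ^+ k] is what makes the induction close; it is dropped afterwards. *)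
  have : forall k, cnorm (s (i + k)%N - s i) * (1 - cnorm z) <=
      cnorm z ^+ i * (1 - cnorm z ^+ k).
    elim=> [|k IH]; first by rewrite addn0 subrr cnorm0 mul0r expr0 subrr mulr0.
    have le1 : cnorm (s (i + k).+1 - s i) <=
        cnorm (s (i + k)%N - s i) + cnorm z ^+ (i + k).
      rewrite {1}/s big_ord_recr /= -/(s _) addrAC.
      by apply: le_trans (cnormD_le _ _) _; rewrite lerD2l cnorm_expn.
    rewrite addnS; apply: le_trans (ler_wpM2r (ltW q0) le1) _.
    rewrite mulrDl; apply: le_trans (lerD IH (lexx _)) _.
    rewrite exprD exprSr -mulrA -mulrDr ler_wpM2l ?exprn_ge0//.
    by rewrite mulrBr mulr1 addrA subrK.
  move=> /(_ (j - i)%N); rewrite subnKC// => /le_trans; apply.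
  by rewrite ler_piMr ?exprn_ge0// gerBl exprn_ge0.
have small e : 0 < e -> exists N, forall i, (N <= i)%N ->
    cnorm z ^+ i / (1 - cnorm z) < e.
  move=> e0; have [|N NP] := geometric_small z0 z1 (e := e * (1 - cnorm z)).
    exact: mulr_gt0.
  by exists N => i /NP; rewrite ltr_pdivrMr.
have [e e0|l lP] := @cnorm_complete R A s.
  have [N NP] := small _ e0; exists N => i j Ni Nj.
  wlog ij : i j Ni Nj / (i <= j)%N => [H|].
    by case/orP: (leq_total i j) => ?; [|rewrite cdistC]; exact: H.
  by rewrite cdistC; apply: le_lt_trans (sB _ _ ij) (NP _ Ni).
(* Treats left and right multiplication by [1 - z] at once, so that the limit is a two-sided
   inverse. *)
have lim0 (L : A -> A) : (forall x y, L (x - y) = L x - L y) ->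
    (forall x, cnorm (L x) <= (1 + cnorm z) * cnorm x) ->
    (forall N, L (s N) = 1 - z ^+ N) -> L l = 1.
  move=> LB Lle Ls; apply/eqP; rewrite -subr_eq0; apply/eqP/cnorm_small_eq0.
  move=> e e0.
  have p0 : 0 < 1 + cnorm z by rewrite ltr_pwDl.
  have [N NP] := lP _ (divr_gt0 (divr_gt0 e0 (ltr0Sn R 1)) p0).
  have [M MP] := geometric_small z0 z1 (divr_gt0 e0 (ltr0Sn R 1)).
  pose i := maxn N M.
  have -> : L l - 1 = - L (s i - l) - z ^+ i.
    by rewrite LB Ls !opprB addrA addrAC addrK.
  apply: le_lt_trans (cnormD_le _ _) _; rewrite !cnormN [e]splitr ltrD//.
    apply: le_lt_trans (Lle _) _; rewrite mulrC -ltr_pdivlMr//.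
    by apply: NP; rewrite leq_maxl.
  by apply: le_lt_trans (cnorm_expn _ _) (MP _ _); rewrite leq_maxr.
have n1z : cnorm (1 - z) <= 1 + cnorm z.
  by apply: le_trans (cnormD_le _ _) _; rewrite cnormN cnorm1.
exists l; split.
- apply: (lim0 (fun x => x * (1 - z))) => // x; first by move=> y; rewrite mulrBl.
  rewrite mulrC; apply: le_trans (cnormM_le _ _) _.
  by rewrite ler_wpM2l ?cnorm_ge0.
- apply: (lim0 (fun x => (1 - z) * x)) => // x; first by move=> y; rewrite mulrBr.
  by apply: le_trans (cnormM_le _ _) _; rewrite ler_wpM2r ?cnorm_ge0.
Qed.

Lemma invertible_mul (a b : A) : invertible a -> invertible b ->
  invertible (a * b).
Proof.
move=> [a' [a'a aa']] [b' [b'b bb']]; exists (b' * a'); split.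
  by rewrite mulrA -[b' * a' * a]mulrA a'a mulr1.
by rewrite mulrA -[a * b * b']mulrA bb' mulr1.
Qed.

Lemma invertible_sides (a b c : A) :
  invertible (b * a) -> invertible (a * c) -> invertible a.
Proof.
move=> [l [lba _]] [r [_ acr]]; exists (l * b); rewrite -mulrA lba; split=> //.
have -> : l * b = c * r; last by rewrite mulrA.
by rewrite -[LHS]mulr1 -acr -!mulrA [b * _]mulrA [l * _]mulrA lba mul1r.
Qed.

(** Both [a' * b] and [b * a'] lie at distance less than 1 from the unit, so Neumann series give [b]
    a left and a right inverse. *)
Lemma invertible_near (a : A) : invertible a ->
  exists2 e : R, 0 < e & forall b, cnorm (a - b) <= e -> invertible b.
Proof.
move=> [a' [a'a aa']]; pose e := (1 + cnorm a')^-1 / 2.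
have p0 : 0 < 1 + cnorm a' by rewrite ltr_pwDl// cnorm_ge0.
exists e; first by rewrite divr_gt0// invr_gt0.
move=> b ab.
have ea' : e * cnorm a' < 1.
  rewrite /e mulrAC ltr_pdivrMr// mul1r ltr_pdivrMl//.
  rewrite mulr2n; have := cnorm_ge0 a'; lra.
apply: (@invertible_sides _ a' a').
- have -> : a' * b = 1 - a' * (a - b) by rewrite mulrBr a'a subKr.
  apply/neumann_inverse/(le_lt_trans (cnormM_le _ _))/(le_lt_trans _ ea').
  by rewrite mulrC ler_wpM2r ?cnorm_ge0.
- have -> : b * a' = 1 - (a - b) * a' by rewrite mulrBl aa' subKr.
  apply/neumann_inverse/(le_lt_trans (cnormM_le _ _))/(le_lt_trans _ ea').
  by rewrite ler_wpM2r ?cnorm_ge0.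
Qed.

End Neumann.

(** * The product of two C*-algebras, with the maximum norm *)

Section Product.
Variables (R : realType) (A B : cstarType R).
Implicit Types x y : (A * B)%type.

Let pstar x := (star x.1, star x.2).
Let pnorm x := Num.max (cnorm x.1) (cnorm x.2).

Fact pstarD x y : pstar (x + y) = pstar x + pstar y.
Proof. by rewrite /pstar !starD. Qed.
Fact pstarZ (c : R[i]) x : pstar (c *: x) = c^* *: pstar x.
Proof. by rewrite /pstar !starZ. Qed.
Fact pstarM x y : pstar (x * y) = pstar y * pstar x.
Proof. by rewrite /pstar !starM. Qed.
Fact pstarK : involutive pstar.
Proof. by case=> x y; rewrite /pstar !starK. Qed.
Fact pnorm_ge0 x : 0 <= pnorm x.
Proof. by rewrite /pnorm le_max cnorm_ge0. Qed.
Fact pnorm_eq0 x : pnorm x = 0 -> x = 0.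
Proof.
case: x => x y; rewrite /pnorm/= => xy.
have le0 (C : cstarType R) (z : C) : cnorm z <= 0 -> z = 0.
  by move=> z0; apply: cnorm_eq0; apply/le_anti; rewrite z0 cnorm_ge0.
by congr (_, _); apply: le0; rewrite -xy le_max lexx ?orbT.
Qed.
Fact pnormZ (c : R[i]) x : pnorm (c *: x) = complex.Re `|c| * pnorm x.
Proof.
rewrite /pnorm !cnormZ maxr_pMr//.
by have : 0 <= `|c| by []; rewrite lecE => /andP[].
Qed.
Fact pnormD_le x y : pnorm (x + y) <= pnorm x + pnorm y.
Proof.
by rewrite /pnorm ge_max; apply/andP; split; apply: le_trans (cnormD_le _ _) _;
  apply: lerD; rewrite le_max lexx ?orbT.
Qed.
Fact pnormM_le x y : pnorm (x * y) <= pnorm x * pnorm y.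
Proof.
by rewrite /pnorm ge_max; apply/andP; split; apply: le_trans (cnormM_le _ _) _;
  apply: ler_pM; rewrite ?cnorm_ge0// le_max lexx ?orbT.
Qed.
Fact pnorm_starM x : pnorm (pstar x * x) = pnorm x ^+ 2.
Proof.
rewrite /pnorm /= !cnorm_starM.
case: (leP (cnorm x.1) (cnorm x.2)) => [xy|/ltW xy]; [apply: max_r|apply: max_l];
  by rewrite ler_pXn2r ?nnegrE ?cnorm_ge0.
Qed.
Fact pnorm_complete (u : nat -> (A * B)%type) :
  (forall e, 0 < e -> exists N : nat, forall i j : nat,
     (N <= i)%N -> (N <= j)%N -> pnorm (u i - u j) < e) ->
  exists l, forall e, 0 < e -> exists N : nat, forall i : nat,
     (N <= i)%N -> pnorm (u i - l) < e.
Proof.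
move=> cu.
have [|a aP] := @cnorm_complete R A (fst \o u).
  move=> e /cu[N NP]; exists N => i j Ni Nj.
  by apply: le_lt_trans (NP i j Ni Nj); rewrite le_max lexx.
have [|b bP] := @cnorm_complete R B (snd \o u).
  move=> e /cu[N NP]; exists N => i j Ni Nj.
  by apply: le_lt_trans (NP i j Ni Nj); rewrite le_max lexx orbT.
exists (a, b) => e e0; have [N NP] := aP _ e0; have [M MP] := bP _ e0.
exists (maxn N M) => i; rewrite geq_max => /andP[/NP ? /MP ?].
by rewrite /pnorm gt_max; apply/andP.
Qed.

HB.instance Definition _ := isCStarAlgebra.Build R (A * B)%type
  pstarD pstarZ pstarM pstarK pnorm_ge0 pnorm_eq0 pnormZ pnormD_le pnormM_le
  pnorm_starM pnorm_complete.

Lemma fst_hom : unital_star_hom (@fst A B : (A * B)%type -> A).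
Proof. by split. Qed.
Lemma snd_hom : unital_star_hom (@snd A B : (A * B)%type -> B).
Proof. by split. Qed.

End Product.

(** * Closed unital *-subalgebras as C*-algebras *)

Record closed_star_subalg (R : realType) (A : cstarType R) (D : A -> Prop) := {
  csub1 : D 1;
  csubP : forall (c : R[i]) x y, D x -> D y -> D (c *: x + y);
  csubM : forall x y, D x -> D y -> D (x * y);
  csub_star : forall x, D x -> D (star x);
  csub_closed : forall x,
    (forall e, 0 < e -> exists2 y, D y & cnorm (x - y) < e) -> D x }.

Section SubCStar.
Variables (R : realType) (A : cstarType R) (D : A -> Prop).
Variable (HD : closed_star_subalg D).

Definition csub_pred (_ : closed_star_subalg D) : {pred A} := fun x => `[<D x>].

Fact csub_subalg_closed : GRing.subsemialg_closed (csub_pred HD).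
Proof.
have D0 : D 0.
  by have := csubP HD (-1) (csub1 HD) (csub1 HD); rewrite scaleN1r addNr.
split.
- exact/asboolP/(csub1 HD).
- split; first exact/asboolP.
  move=> x y /asboolP Dx /asboolP Dy; apply/asboolP; rewrite -[x]scale1r.
  exact: csubP.
- move=> c x /asboolP Dx; apply/asboolP; rewrite -[_ *: _]addr0.
  exact: csubP.
- by move=> x y /asboolP Dx /asboolP Dy; apply/asboolP; exact: csubM.
Qed.

HB.instance Definition _ := GRing.isSubalgClosed.Build R[i] A (csub_pred HD)
  csub_subalg_closed.

Record csub := CSub { csub_val : A; _ : csub_val \in csub_pred HD }.

HB.instance Definition _ := [isSub for csub_val].
HB.instance Definition _ := [Choice of csub by <:].
HB.instance Definition _ := [SubChoice_isSubAlgebra of csub by <:].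

Lemma csub_valP (x : csub) : D (csub_val x).
Proof. by case: x => x /= /asboolP. Qed.

Definition csub_mk x (Dx : D x) : csub := CSub (asboolT Dx).

Let sstar (x : csub) := csub_mk (csub_star HD (csub_valP x)).
Let snorm (x : csub) := cnorm (csub_val x).

Fact sstarD x y : sstar (x + y) = sstar x + sstar y.
Proof. exact/val_inj/starD. Qed.
Fact sstarZ (c : R[i]) x : sstar (c *: x) = c^* *: sstar x.
Proof. exact/val_inj/starZ. Qed.
Fact sstarM x y : sstar (x * y) = sstar y * sstar x.
Proof. exact/val_inj/starM. Qed.
Fact sstarK : involutive sstar.
Proof. by move=> x; apply/val_inj/starK. Qed.
Fact snorm_ge0 x : 0 <= snorm x. Proof. exact: cnorm_ge0. Qed.
Fact snorm_eq0 x : snorm x = 0 -> x = 0.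
Proof. by move=> x0; apply/val_inj/cnorm_eq0. Qed.
Fact snormZ (c : R[i]) x : snorm (c *: x) = complex.Re `|c| * snorm x.
Proof. exact: cnormZ. Qed.
Fact snormD_le x y : snorm (x + y) <= snorm x + snorm y.
Proof. exact: cnormD_le. Qed.
Fact snormM_le x y : snorm (x * y) <= snorm x * snorm y.
Proof. exact: cnormM_le. Qed.
Fact snorm_starM x : snorm (sstar x * x) = snorm x ^+ 2.
Proof. exact: cnorm_starM. Qed.
Fact snorm_complete (u : nat -> csub) :
  (forall e, 0 < e -> exists N : nat, forall i j : nat,
     (N <= i)%N -> (N <= j)%N -> snorm (u i - u j) < e) ->
  exists l, forall e, 0 < e -> exists N : nat, forall i : nat,
     (N <= i)%N -> snorm (u i - l) < e.
Proof.
move=> /(@cnorm_complete R A (csub_val \o u))[l lP].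
have Dl : D l.
  apply: (csub_closed HD) => e /lP[N NP]; exists (csub_val (u N)).
    exact: csub_valP.
  by rewrite cdistC; exact: NP.
by exists (csub_mk Dl).
Qed.

HB.instance Definition _ := isCStarAlgebra.Build R csub
  sstarD sstarZ sstarM sstarK snorm_ge0 snorm_eq0 snormZ snormD_le snormM_le
  snorm_starM snorm_complete.

Lemma csub_val_hom : unital_star_hom csub_val.
Proof. by split. Qed.

Lemma csub_val_sum I (r : seq I) (P : pred I) (F : I -> csub) :
  csub_val (\sum_(i <- r | P i) F i) = \sum_(i <- r | P i) csub_val (F i).
Proof. exact: (big_morph csub_val (fun _ _ => erefl) erefl). Qed.

End SubCStar.

(** * Homomorphisms out of O_n: uniqueness and approximation of values *)

Section Density.
Variables (R : realType) (n : nat) (O : cuntzAlgebra R n).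

Lemma unital_star_hom_comp (A B C : cstarType R) (f : A -> B) (g : B -> C) :
  unital_star_hom f -> unital_star_hom g -> unital_star_hom (g \o f).
Proof.
move=> [fD fZ fM f1 fs] [gD gZ gM g1 gs]; split=> [x y|c x|x y||x] /=.
- by rewrite fD gD.
- by rewrite fZ gZ.
- by rewrite fM gM.
- by rewrite f1 g1.
- by rewrite fs gs.
Qed.

Lemma cuntz_hom_unique (B : cstarType R) (f g : O -> B) :
  unital_star_hom f -> unital_star_hom g ->
  (forall i, f (cuntz_gen O i) = g (cuntz_gen O i)) -> f = g.
Proof.
move=> fh gh fg; have [[SS SSt] U] := cuntz_genP O.
have rel : cuntz_rel (fun i => f (cuntz_gen O i)).
  case: fh => fD fZ fM f1 fs; split.
    by move=> i; rewrite -fs -fM SS.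
  have f0 : f 0 = 0 by apply: (addrI (f 0)); rewrite -fD !addr0.
  rewrite -f1 -SSt (big_morph f fD f0); apply: eq_bigr => i _.
  by rewrite fM fs.
have [h [_ hU]] := U _ _ rel.
rewrite -(hU f)// -(hU g)//; split=> // i; exact/esym/fg.
Qed.

(* The norm closure of D is a C*-algebra containing T, so the universal
   homomorphism can be chosen with values in it. *)
Lemma cuntz_hom_dense (B : cstarType R) (T : 'I_n -> B) (D : B -> Prop) :
  cuntz_rel T -> D 1 -> (forall (c : R[i]) x y, D x -> D y -> D (c *: x + y)) ->
  (forall x y, D x -> D y -> D (x * y)) -> (forall x, D x -> D (star x)) ->
  (forall i, D (T i)) ->
  exists2 phi : O -> B, unital_star_hom phi /\
      (forall i, phi (cuntz_gen O i) = T i) &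
    forall a e, 0 < e -> exists2 b, D b & cnorm (phi a - b) < e.
Proof.
move=> [TT TTt] D1 DP DM Ds DT.
pose C x := forall e : R, 0 < e -> exists2 y, D y & cnorm (x - y) < e.
have DC x : D x -> C x by move=> Dx e e0; exists x; rewrite ?subrr ?cnorm0.
have HC : closed_star_subalg C.
  split; first exact: DC.
  - move=> c x y Cx Cy e e0.
    have c0 : 0 <= complex.Re `|c| :> R.
      by have : 0 <= `|c| by []; rewrite lecE => /andP[].
    have e2 : 0 < e / 2 by rewrite divr_gt0.
    have d0 : 0 < e / 2 / (1 + complex.Re `|c|) by rewrite divr_gt0// ltr_pwDl.
    have [x' Dx' xx'] := Cx _ d0; have [y' Dy' yy'] := Cy _ e2.
    exists (c *: x' + y'); first exact: DP.
    rewrite opprD addrACA -scalerBr; apply: le_lt_trans (cnormD_le _ _) _.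
    rewrite [e]splitr ltrD// cnormZ.
    apply: le_lt_trans (_ : (1 + complex.Re `|c|) * cnorm (x - x') < _).
      by rewrite ler_wpM2r ?cnorm_ge0// lerDr.
    by rewrite mulrC -ltr_pdivlMr// ltr_pwDl.
  - move=> x y Cx Cy e e0.
    (* [M] has to bound the approximant [y'] as well as [x]; the summand [e] accounts for the
       distance from [y'] to [y]. *)
    pose M := 1 + cnorm x + cnorm y + e.
    have x0 := cnorm_ge0 x; have y0 := cnorm_ge0 y.
    have M0 : 0 < M by rewrite /M; lra.
    have d0 : 0 < e / 2 / M by rewrite !divr_gt0.
    have de : e / 2 / M < e.
      by rewrite ltr_pdivrMr// ltr_pdivrMr// /M; nra.
    have [x' Dx' xx'] := Cx _ d0; have [y' Dy' yy'] := Cy _ d0.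
    exists (x' * y'); first exact: DM.
    have -> : x * y - x' * y' = (x - x') * y' + x * (y - y').
      by rewrite mulrBl mulrBr [RHS]addrC addrA subrK.
    have y'M : cnorm y' <= M.
      have := cnormD_le (y' - y) y; rewrite subrK cdistC /M => ?; lra.
    have xM : cnorm x <= M by rewrite /M; lra.
    apply: le_lt_trans (cnormD_le _ _) _; rewrite [e]splitr.
    apply: le_lt_trans (lerD (cnormM_le _ _) (cnormM_le _ _)) _.
    apply: ltr_leD.
      apply: le_lt_trans (ler_wpM2l (cnorm_ge0 _) y'M) _.
      by rewrite -ltr_pdivlMr.
    apply: le_trans (ler_wpM2r (cnorm_ge0 _) xM) _.
    by rewrite mulrC -ler_pdivlMr// ltW.
  - move=> x Cx e /Cx[y Dy xy]; exists (star y); first exact: Ds.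
    by rewrite -starB cnorm_star.
  - move=> x Cx e e0; have e2 : 0 < e / 2 by rewrite divr_gt0.
    have [y /(_ _ e2)[z Dz yz] xy] := Cx _ e2; exists z => //.
    apply: le_lt_trans (cnorm_dist _ y _) _.
    by rewrite [e]splitr ltrD.
pose T' i : csub HC := csub_mk HC (DC _ (DT i)).
have [|phi [[phiH phiS] _]] := (cuntz_genP O).2 (csub HC) T'.
  split=> [i|]; apply: val_inj; first exact: TT.
  by rewrite /= csub_val_sum.
exists (@csub_val _ _ _ HC \o phi).
  split; first exact: unital_star_hom_comp (csub_val_hom HC).
  by move=> i; rewrite /= phiS.
by move=> a; exact: (csub_valP (phi a)).
Qed.

End Density.

(** * The Hilbert space spanned by orthonormal isometries *)

Section ComplexNorm.
Variable R : realType.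
Implicit Types c : R[i].

Lemma normc_conjM c : c^* * c = ((normc c) ^+ 2)%:C.
Proof. by rewrite mulrC -sqr_normc rmorphXn. Qed.

Lemma normc_ge0 c : 0 <= normc c.
Proof. by case: c => a b; exact: sqrtr_ge0. Qed.

Lemma normc_real (r : R) : 0 <= r -> normc r%:C = r.
Proof. by move=> r0; rewrite /= expr0n addr0 sqrtr_sqr ger0_norm. Qed.

Lemma normcX c k : normc (c ^+ k) = normc c ^+ k.
Proof.
by elim: k => [|k IH]; rewrite ?expr0 ?normc1// !exprS normcM IH.
Qed.

Lemma real_cauchy_lim (u : nat -> R) :
  (forall e, 0 < e -> exists N : nat, forall i j : nat,
     (N <= i)%N -> (N <= j)%N -> `|u i - u j| < e) ->
  exists l : R, forall e, 0 < e -> exists N : nat, forall i : nat,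
     (N <= i)%N -> `|u i - l| < e.
Proof.
move=> cu; have : cauchy (u @ \oo).
  apply/cauchyP => /= e e0; have [N NP] := cu _ e0; exists (u N).
  by exists N => // i /= Ni; apply: NP.
move=> /cauchy_cvgP/cvg_ex[l ul]; exists l => e e0.
have /cvgrPdist_lt/(_ _ e0)[N _ NP] := ul.
by exists N => i /NP /=; rewrite distrC.
Qed.

Lemma complex_cauchy_lim (u : nat -> R[i]) :
  (forall e, 0 < e -> exists N : nat, forall i j : nat,
     (N <= i)%N -> (N <= j)%N -> normc (u i - u j) < e) ->
  exists l : R[i], forall e, 0 < e -> exists N : nat, forall i : nat,
     (N <= i)%N -> normc (u i - l) < e.
Proof.
have Rele (c : R[i]) : `|complex.Re c| <= normc c.
  by have := normc_ge_Re c; rewrite lecE => /andP[].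
have Imle (c : R[i]) : `|complex.Im c| <= normc c.
  case: c => a b /=; rewrite -[`|b|]ger0_norm// -sqrtr_sqr ler_sqrt.
    by rewrite real_normK ?num_real// lerDr sqr_ge0.
  by rewrite addr_ge0 ?sqr_ge0.
have normcle (c : R[i]) : normc c <= `|complex.Re c| + `|complex.Im c|.
  case: c => a b /=; rewrite -[leRHS]ger0_norm ?addr_ge0// -sqrtr_sqr ler_sqrt.
    rewrite sqrrD !real_normK ?num_real// [leRHS]addrAC.
    by rewrite lerDl mulrn_wge0 ?mulr_ge0.
  by rewrite sqr_ge0.
have ReB (c d : R[i]) : complex.Re (c - d) = complex.Re c - complex.Re d.
  by case: c d => [? ?] [].
have ImB (c d : R[i]) : complex.Im (c - d) = complex.Im c - complex.Im d.
  by case: c d => [? ?] [].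
move=> cu.
have [|a aP] := @real_cauchy_lim (fun k => complex.Re (u k)).
  move=> e /cu[N NP]; exists N => i j Ni Nj.
  by apply: le_lt_trans (NP i j Ni Nj); rewrite -ReB.
have [|b bP] := @real_cauchy_lim (fun k => complex.Im (u k)).
  move=> e /cu[N NP]; exists N => i j Ni Nj.
  by apply: le_lt_trans (NP i j Ni Nj); rewrite -ImB.
exists (a +i* b) => e e0; have e2 : 0 < e / 2 by rewrite divr_gt0.
have [N NP] := aP _ e2; have [M MP] := bP _ e2.
exists (maxn N M) => i; rewrite geq_max => /andP[/NP ia /MP ib].
by apply: le_lt_trans (normcle _) _; rewrite ReB ImB [e]splitr ltrD.
Qed.

Lemma cnormZc (A : cstarType R) (c : R[i]) (x : A) :
  cnorm (c *: x) = normc c * cnorm x.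
Proof. exact: cnormZ. Qed.

End ComplexNorm.

Section HilbertSpan.
Variables (R : realType) (A : cstarType R) (e : nat -> A).
Hypothesis ortho : forall x y, star (e x) * e y = (x == y)%:R.

Implicit Types (f : nat -> A) (p q : {poly R[i]}) (v w : A).

(** A polynomial serves as a finitely supported sequence of coefficients. *)
Definition lincomb f (p : {poly R[i]}) : A :=
  \sum_(x < size p) p`_x *: f x.

Lemma lincombE f p N : (size p <= N)%N -> lincomb f p = \sum_(x < N) p`_x *: f x.
Proof.
move=> pN; rewrite /lincomb (big_ord_widen N (fun x => p`_x *: f x) pN).
rewrite [RHS](bigID (fun x : 'I_N => (x < size p)%N)) /= [X in _ = _ + X]big1 ?addr0//.
by move=> x; rewrite -leqNgt => px; rewrite nth_default// scale0r.
Qed.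

Lemma lincombP f (c : R[i]) p q :
  lincomb f (c *: p + q) = c *: lincomb f p + lincomb f q.
Proof.
pose N := maxn (size (c *: p + q)) (maxn (size p) (size q)).
rewrite !(@lincombE f _ N) ?leq_max ?leqnn ?orbT// scaler_sumr -big_split.
by apply: eq_bigr => x _ /=; rewrite coefD coefZ scalerDl scalerA.
Qed.

Lemma lincombXn f y : lincomb f 'X^y = f y.
Proof.
rewrite (@lincombE f _ y.+1) ?size_polyXn// (bigD1 ord_max)//= coefXn eqxx.
rewrite scale1r big1 ?addr0// => x xy.
by rewrite coefXn (negbTE (xy : _ != y :> nat)) scale0r.
Qed.

Lemma cnorm_scalar (c : R[i]) : cnorm (c *: 1 : A) = normc c.
Proof. by rewrite cnormZc cnorm1 mulr1. Qed.

Lemma scalar_inj (c d : R[i]) : c *: 1 = d *: 1 :> A -> c = d.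
Proof.
move=> /eqP; rewrite -subr_eq0 -scalerBl => /eqP cd; apply/eqP.
by rewrite -subr_eq0; apply/eqP/eq0_normc; rewrite -cnorm_scalar cd cnorm0.
Qed.

Lemma coef_lincomb x p : star (e x) * lincomb e p = p`_x *: 1.
Proof.
pose N := maxn x.+1 (size p).
have xN : (x < N)%N by rewrite leq_max leqnn.
rewrite (@lincombE e _ N) ?leq_max ?leqnn ?orbT// mulr_sumr.
rewrite (bigD1 (Ordinal xN))//= -scalerAr ortho eqxx big1 ?addr0// => y yx.
rewrite -scalerAr ortho eq_sym (negbTE (yx : _ != x :> nat)) scaler0//.
Qed.

(** Pythagoras, since the scalar [star v * w] plays the part of an inner product. The weight [w]
    lets some of the [f x] vanish, as for the image of a basis under a partial shift. *)
Lemma cnorm_lincomb f (w : nat -> bool) p :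
  (forall x y, star (f x) * f y = ((x == y) && w x)%:R) ->
  cnorm (lincomb f p) ^+ 2 = \sum_(x < size p) (w x)%:R * normc p`_x ^+ 2.
Proof.
move=> fw; rewrite -cnorm_starM /lincomb star_sum mulr_suml.
under eq_bigr => x _.
  rewrite mulr_sumr (bigD1 x)//= big1 ?addr0; last first.
    move=> y yx; rewrite starZ -scalerAl -scalerAr fw eq_sym.
    by rewrite (negbTE (yx : _ != x :> nat)) !scaler0.
  rewrite starZ -scalerAl -scalerAr scalerA fw eqxx/= normc_conjM.
  rewrite -[(w x)%:R]mul1r mulr_natr -scaler_nat scalerA.
  over.
rewrite -scaler_suml cnorm_scalar.
have -> : \sum_(x < size p) ((normc p`_x ^+ 2)%:C * (w x)%:R) =
    (\sum_(x < size p) (w x)%:R * normc p`_x ^+ 2)%:C :> R[i].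
  rewrite rmorph_sum; apply: eq_bigr => x _.
  by rewrite [RHS]rmorphM rmorph_nat mulrC.
apply: normc_real; apply: sumr_ge0 => x _.
by rewrite mulr_ge0// sqr_ge0.
Qed.

Definition in_span v := forall eps, 0 < eps ->
  exists p, cnorm (v - lincomb e p) < eps.

Lemma in_span_closed v : (forall eps, 0 < eps -> exists2 w, in_span w &
  cnorm (v - w) < eps) -> in_span v.
Proof.
move=> cv eps e0; have e2 : 0 < eps / 2 by rewrite divr_gt0.
have [w /(_ _ e2)[p wp] vw] := cv _ e2; exists p.
apply: le_lt_trans (cnorm_dist _ w _) _.
by rewrite [eps]splitr ltrD.
Qed.

Lemma in_span_lincomb p : in_span (lincomb e p).
Proof. by move=> eps e0; exists p; rewrite subrr cnorm0. Qed.

Lemma in_span_linear (c : R[i]) v w :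
  in_span v -> in_span w -> in_span (c *: v + w).
Proof.
move=> sv sw eps e0.
have e2 : 0 < eps / 2 by rewrite divr_gt0.
have d0 : 0 < eps / 2 / (1 + normc c) by rewrite divr_gt0// ltr_pwDl ?normc_ge0.
have [p vp] := sv _ d0; have [q wq] := sw _ e2; exists (c *: p + q).
rewrite lincombP opprD addrACA -scalerBr; apply: le_lt_trans (cnormD_le _ _) _.
rewrite [eps]splitr ltrD// cnormZc.
apply: le_lt_trans (_ : (1 + normc c) * cnorm (v - lincomb e p) < _).
  by rewrite ler_wpM2r ?cnorm_ge0// lerDr.
by rewrite mulrC -ltr_pdivlMr// ltr_pwDl ?normc_ge0.
Qed.

Lemma in_span0 : in_span 0.
Proof. by rewrite -(subrr (lincomb e 0)) addrC -scaleN1r; apply: in_span_linear; exact: in_span_lincomb. Qed.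

Lemma in_spanM a :
  (forall x, in_span (a * e x)) -> forall v, in_span v -> in_span (a * v).
Proof.
move=> ae v sv; apply: in_span_closed => eps e0.
have a0 : 0 < 1 + cnorm a by rewrite ltr_pwDl ?cnorm_ge0.
have [p vp] := sv _ (divr_gt0 e0 a0); exists (a * lincomb e p).
  rewrite /lincomb mulr_sumr; elim/big_rec: _ => [|x w _ sw]; first exact: in_span0.
  by rewrite -scalerAr; exact: in_span_linear.
rewrite -mulrBr; apply: le_lt_trans (cnormM_le _ _) _.
apply: le_lt_trans (_ : (1 + cnorm a) * cnorm (v - lincomb e p) < _).
  by rewrite ler_wpM2r ?cnorm_ge0// lerDr.
by rewrite mulrC -ltr_pdivlMr.
Qed.

End HilbertSpan.

Section HilbertSpace.
Variables (R : realType) (A : cstarType R) (e : nat -> A).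
Hypothesis ortho : forall x y, star (e x) * e y = (x == y)%:R.

Definition hspace_pred : {pred A} := fun v => `[<in_span e v>].

Fact hspace_submod_closed : submod_closed hspace_pred.
Proof.
split; first exact/asboolP/in_span0.
move=> c v w /asboolP sv /asboolP sw; apply/asboolP; exact: in_span_linear.
Qed.

HB.instance Definition _ := GRing.isSubmodClosed.Build R[i] A hspace_pred
  (GRing.submod_closed_semi hspace_submod_closed).

Record hspace := HSpace { hval : A; _ : hval \in hspace_pred }.

HB.instance Definition _ := [isSub for hval].
HB.instance Definition _ := [Choice of hspace by <:].
HB.instance Definition _ := [SubChoice_isSubLmodule of hspace by <:].

Lemma hvalP (v : hspace) : in_span e (hval v).
Proof. by case: v => v /= /asboolP. Qed.

Definition hmk (v : A) (sv : in_span e v) : hspace := HSpace (asboolT sv).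

Definition evec (x : nat) : hspace.
Proof. by apply: (@hmk (e x)); rewrite -[e x](lincombXn e); exact: in_span_lincomb. Defined.

Lemma hspace_approx (v : hspace) : exists p : nat -> {poly R[i]},
  forall eps : R, 0 < eps -> exists N : nat, forall k, (N <= k)%N ->
    cnorm (hval v - lincomb e (p k)) < eps.
Proof.
have /choice[p pP] : forall k : nat, exists p : {poly R[i]},
    cnorm (hval v - lincomb e p) < k.+1%:R^-1.
  by move=> k; apply: (hvalP v); rewrite invr_gt0.
exists p => eps e0.
have [N _ NP] := near_infty_natSinv_lt (PosNum e0).
by exists N => k /NP; exact: lt_trans.
Qed.

Lemma cnorm_star_ortho x : cnorm (star (e x)) = 1.
Proof.
apply/eqP; rewrite cnorm_star -(@eqrXn2 _ 2) ?cnorm_ge0//.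
by rewrite -cnorm_starM ortho eqxx cnorm1 expr1n.
Qed.

(** The coefficients of the approximating combinations are Cauchy because multiplication by
    [star (e x)] does not increase the norm, and their limit is the coordinate. *)
Lemma hcoord_ex x (v : hspace) : exists c : R[i], star (e x) * hval v = c *: 1.
Proof.
have [p pP] := hspace_approx v.
have ex1 := cnorm_star_ortho x.
have dist eps k : cnorm (hval v - lincomb e (p k)) < eps ->
    cnorm (star (e x) * hval v - (p k)`_x *: 1) < eps.
  rewrite -(coef_lincomb ortho) -mulrBr; apply: le_lt_trans.
  by apply: le_trans (cnormM_le _ _) _; rewrite ex1 mul1r.
have [|c cP] := @complex_cauchy_lim R (fun k => (p k)`_x).
  move=> eps e0; have e2 : 0 < eps / 2 by rewrite divr_gt0.
  have [N NP] := pP _ e2; exists N => i j Ni Nj.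
  rewrite -(cnorm_scalar A) scalerBl.
  apply: le_lt_trans (cnorm_dist _ (star (e x) * hval v) _) _.
  by rewrite [eps]splitr ltrD//; [rewrite cdistC|]; apply/dist/NP.
exists c; apply/eqP; rewrite -subr_eq0; apply/eqP/cnorm_small_eq0 => eps e0.
have e2 : 0 < eps / 2 by rewrite divr_gt0.
have [N NP] := pP _ e2; have [M MP] := cP _ e2.
pose k := maxn N M.
apply: le_lt_trans (cnorm_dist _ ((p k)`_x *: 1) _) _.
rewrite [eps]splitr ltrD//.
  by apply/dist/NP; rewrite leq_maxl.
by rewrite -scalerBl cnorm_scalar MP// leq_maxr.
Qed.

Definition hcoord (v : hspace) x : R[i] := sval (cid (hcoord_ex x v)).

Lemma hcoordE v x : star (e x) * hval v = hcoord v x *: 1.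
Proof. by rewrite /hcoord; case: cid. Qed.

Lemma hcoord_eq v x c : star (e x) * hval v = c *: 1 -> hcoord v x = c.
Proof. by rewrite hcoordE => /scalar_inj. Qed.

Lemma hcoordP (c : R[i]) v w x : hcoord (c *: v + w) x = c * hcoord v x + hcoord w x.
Proof.
by apply: hcoord_eq; rewrite /= mulrDr -scalerAr !hcoordE scalerDl scalerA.
Qed.

Lemma hcoord0 x : hcoord 0 x = 0.
Proof. by apply: hcoord_eq; rewrite /= mulr0 scale0r. Qed.

Lemma hcoordB v w x : hcoord (v - w) x = hcoord v x - hcoord w x.
Proof. by rewrite addrC -scaleN1r hcoordP mulN1r addrC. Qed.

Lemma hcoord_sum I (r : seq I) (F : I -> hspace) x :
  hcoord (\sum_(i <- r) F i) x = \sum_(i <- r) hcoord (F i) x.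
Proof.
have cD v w : hcoord (v + w) x = hcoord v x + hcoord w x.
  by rewrite -[v]scale1r hcoordP mul1r scale1r.
exact: (big_morph (hcoord ^~ x) cD (hcoord0 x)).
Qed.

Lemma hcoordZ (c : R[i]) v x : hcoord (c *: v) x = c * hcoord v x.
Proof. by rewrite -[c *: v]addr0 hcoordP hcoord0 addr0. Qed.

Lemma hcoord_evec x y : hcoord (evec x) y = (y == x)%:R.
Proof. by apply: hcoord_eq; rewrite ortho scaler_nat. Qed.

(** A vector d orthogonal to the basis satisfies |d|^2 <= |d - p| |d| for every finite combination
    p, and such p come arbitrarily close to d. *)
Lemma hcoord_inj v w : (forall x, hcoord v x = hcoord w x) -> v = w.
Proof.
move=> vw; apply/eqP; rewrite -subr_eq0; set d := v - w.
have cd x : star (e x) * hval d = 0 by rewrite hcoordE hcoordB vw subrr scale0r.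
have ld p : star (lincomb e p) * hval d = 0.
  rewrite star_sum mulr_suml big1// => x _.
  by rewrite starZ -scalerAl cd scaler0.
apply/eqP/val_inj/cnorm_small_eq0 => eps e0 /=.
have [->|] := eqVneq (cnorm (hval d)) 0; first by [].
rewrite neq_lt ltNge cnorm_ge0/= => d0.
have [p dp] := hvalP d e0.
apply: le_lt_trans dp; rewrite -(ler_pM2r d0) -expr2 -cnorm_starM.
rewrite -[X in cnorm X]subr0 -(ld p) -mulrBl -starB.
by apply: le_trans (cnormM_le _ _) _; rewrite cnorm_star.
Qed.

Definition partial_inj (q : nat -> option nat) :=
  exists r, forall x y, r x = Some y <-> q y = Some x.

(** Moving and deleting basis vectors contracts the norm of finite combinations, so it extends to
    the closed span by completeness. Here [q] pulls coordinates back while its inverse [r] pushes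
    basis vectors forward. *)
Lemma shift_ex q : partial_inj q -> forall v, exists w,
  forall y, hcoord w y = if q y is Some x then hcoord v x else 0.
Proof.
move=> [r rq] v.
pose f x := if r x is Some y then e y else 0.
have fo x y : star (f x) * f y = ((x == y) && r x)%:R.
  rewrite /f; case: eqVneq => [<-|xy] /=.
    by case: (r x) => [z|]; rewrite ?ortho ?eqxx ?mulr0.
  case rx : (r x) => [z|]; last by rewrite star0 mul0r.
  case ry : (r y) => [t|]; last by rewrite mulr0.
  rewrite ortho; case: eqP => // zt; move: rx ry; rewrite zt => /rq + /rq.
  by move=> -> [/eqP]; rewrite (negbTE xy).
have fe p : cnorm (lincomb f p) <= cnorm (lincomb e p).
  rewrite -(@ler_pXn2r _ 2) ?nnegrE ?cnorm_ge0//.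
  rewrite (@cnorm_lincomb _ _ f (fun x => r x) p fo).
  rewrite (@cnorm_lincomb _ _ e xpredT p) => [|x y]; last by rewrite andbT.
  apply: ler_sum => x _; rewrite ler_wpM2r ?sqr_ge0//.
  by case: (r x : bool).
have [p pP] := hspace_approx v.
have sf u : in_span e (lincomb f u).
  rewrite /lincomb; elim/big_rec: _ => [|x w _ sw]; first exact: in_span0.
  apply: in_span_linear => //; rewrite /f; case: (r x) => [y|].
    exact: (hvalP (evec y)).
  exact: in_span0.
have linB g a b : lincomb g a - lincomb g b = lincomb g (a - b).
  by rewrite addrC -scaleN1r -lincombP scaleN1r addrC.
have [|w wP] := @cnorm_complete R A (fun k => lincomb f (p k)).
  move=> eps e0; have e2 : 0 < eps / 2 by rewrite divr_gt0.
  have [N NP] := pP _ e2; exists N => i j Ni Nj.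
  rewrite linB; apply: le_lt_trans (fe _) _; rewrite -linB.
  apply: le_lt_trans (cnorm_dist _ (hval v) _) _.
  by rewrite [eps]splitr; apply: ltrD; [rewrite cdistC|]; exact: NP.
have sw : in_span e w.
  apply: in_span_closed => eps /wP[N NP]; exists (lincomb f (p N)) => //.
  by rewrite cdistC NP.
exists (hmk sw) => y; apply: hcoord_eq => /=.
have ex1 := cnorm_star_ortho.
have cf k : star (e y) * lincomb f (p k) =
    if q y is Some x then star (e x) * lincomb e (p k) else 0.
  have ef x : star (e y) * f x = (q y == Some x)%:R.
    rewrite /f; case rx : (r x) => [z|]; last first.
      by rewrite mulr0; case: eqP => // /rq; rewrite rx.
    rewrite ortho; congr (_%:R : A); congr nat_of_bool; apply/eqP/eqP => [->|].
      exact/rq.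
    by move=> /rq; rewrite rx => -[].
  rewrite /lincomb; case qy : (q y) => [x|]; last first.
    by rewrite mulr_sumr big1// => x _; rewrite -scalerAr ef qy scaler0.
  rewrite !mulr_sumr; apply: eq_bigr => z _.
  by rewrite -!scalerAr ef ortho qy.
apply/eqP; rewrite -subr_eq0; apply/eqP/cnorm_small_eq0 => eps e0.
have e2 : 0 < eps / 2 by rewrite divr_gt0.
have [N NP] := pP _ e2; have [M MP] := wP _ e2.
pose k := maxn N M.
have Nk := NP k (leq_maxl _ _); have Mk := MP k (leq_maxr _ _).
apply: le_lt_trans (cnorm_dist _ (star (e y) * lincomb f (p k)) _) _.
rewrite [eps]splitr ltrD//.
  rewrite -mulrBr; apply: le_lt_trans Mk.
  by apply: le_trans (cnormM_le _ _) _; rewrite ex1 mul1r cdistC.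
rewrite cf; case: (q y) => [x|]; last by rewrite scale0r subrr cnorm0.
rewrite -hcoordE -mulrBr; apply: le_lt_trans Nk.
by apply: le_trans (cnormM_le _ _) _; rewrite ex1 mul1r cdistC.
Qed.

End HilbertSpace.

(** * Shifts, traces and left multiplications on the Hilbert space *)

Section Operators.
Variables (R : realType) (A : cstarType R) (e : nat -> A).
Hypothesis ortho : forall x y, star (e x) * e y = (x == y)%:R.
Local Notation H := (hspace e).
Local Notation hcoord := (hcoord ortho).

Lemma endo_hcoordP (f g : endo H) :
  (forall v y, hcoord (f v) y = hcoord (g v) y) -> f = g.
Proof. by move=> fg; apply/endoP => v; apply: (hcoord_inj (ortho := ortho)). Qed.

Definition shift_fun q (hq : partial_inj q) (v : H) : H :=
  sval (cid (shift_ex ortho hq v)).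

Lemma shift_funE q (hq : partial_inj q) v y :
  hcoord (shift_fun hq v) y = if q y is Some x then hcoord v x else 0.
Proof. by rewrite /shift_fun; case: cid. Qed.

Lemma shift_linear q (hq : partial_inj q) : linear (shift_fun hq).
Proof.
move=> c v w; apply: (hcoord_inj (ortho := ortho)) => y.
rewrite hcoordP !shift_funE; case: (q y) => [x|]; last by rewrite mulr0 addr0.
exact: hcoordP.
Qed.

Definition hshift q (hq : partial_inj q) : endo H := mkendo (shift_linear hq).

Lemma hshiftE q (hq : partial_inj q) v y :
  hcoord (hshift hq v) y = if q y is Some x then hcoord v x else 0.
Proof. exact: shift_funE. Qed.

Lemma has_trace_coord N (h : endo H) :
  (forall v y, (N <= y)%N -> hcoord (h v) y = 0) ->
  has_trace h (\sum_(y < N) hcoord (h (evec e y)) y).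
Proof.
move=> hN; pose k v := \row_(j < N) hcoord (h v) j.
have k_lin : linear k.
  by move=> c v w; apply/rowP => j; rewrite !mxE linearP hcoordP.
exists N, (mklinear k_lin), (fun j => evec e j); split => [v|]; last first.
  by apply: eq_bigr => j _; rewrite mxE.
apply: (hcoord_inj (ortho := ortho)) => y; rewrite hcoord_sum.
under eq_bigr do rewrite hcoordZ hcoord_evec mxE.
have [yN|Ny] := ltnP y N; last first.
  rewrite hN// big1// => j _; rewrite gtn_eqF ?mulr0//.
  exact: leq_trans (ltn_ord j) Ny.
rewrite (bigD1 (Ordinal yN))//= eqxx mulr1 big1 ?addr0// => j jy.
by rewrite eq_sym (negbTE (jy : _ != y :> nat)) mulr0.
Qed.

(** Asking the same of [star a] makes this a C*-subalgebra, hence a legitimate target for the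
    universal property. *)
Definition stabilizer (a : A) :=
  forall v, in_span e v -> in_span e (a * v) /\ in_span e (star a * v).

Lemma stabilizer_closed : closed_star_subalg stabilizer.
Proof.
split.
- by move=> v sv; rewrite star1 mul1r.
- move=> c x y sx sy v sv; have [xv xv'] := sx _ sv; have [yv yv'] := sy _ sv.
  rewrite starD starZ !mulrDl -!scalerAl; split; exact: in_span_linear.
- move=> x y sx sy v sv; rewrite starM -!mulrA.
  split; first by apply: (sx _ _).1; apply: (sy _ _).1.
  by apply: (sy _ _).2; apply: (sx _ _).2.
- by move=> x sx v /sx[? ?]; rewrite starK.
move=> x cx v sv.
have v0 : 0 < 1 + cnorm v by rewrite ltr_pwDl ?cnorm_ge0.
have close y eps : 0 < eps -> cnorm y < eps / (1 + cnorm v) ->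
    cnorm (y * v) < eps.
  move=> e0 yx; apply: le_lt_trans (cnormM_le _ _) _.
  apply: le_lt_trans (_ : cnorm y * (1 + cnorm v) < _).
    by rewrite ler_wpM2l ?cnorm_ge0// lerDr.
  by rewrite -ltr_pdivlMr.
split; apply: in_span_closed => eps e0.
  have [y sy xy] := cx _ (divr_gt0 e0 v0); exists (y * v).
    exact: (sy _ sv).1.
  by rewrite -mulrBl close.
have [y sy xy] := cx _ (divr_gt0 e0 v0); exists (star y * v).
  exact: (sy _ sv).2.
by rewrite -mulrBl close// -starB cnorm_star.
Qed.

Definition stab := csub stabilizer_closed.

Definition lact_fun (a : stab) (v : H) : H :=
  hmk (csub_valP a (hval v) (hvalP v)).1.

Lemma lact_linear a : linear (lact_fun a).
Proof.
by move=> c v w; apply: val_inj; rewrite /= mulrDr -scalerAr.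
Qed.

Definition lact (a : stab) : endo H := mkendo (lact_linear a).

Lemma lactM a b : lact (a * b) = lact a * lact b.
Proof. by apply/endoP => v; apply: val_inj; rewrite /= mulrA. Qed.

Lemma lact1 : lact 1 = 1.
Proof. by apply/endoP => v; apply: val_inj; rewrite /= mul1r. Qed.

Lemma lactP c a b v : lact (c *: a + b) v = c *: lact a v + lact b v.
Proof. by apply: val_inj; rewrite /= mulrDl scalerAl. Qed.

(** Left multiplications by [a] and [star a] are adjoint, so the coordinates of [a * v] are read off
    from [star a] on basis vectors. *)
Lemma hcoord_lact a v y c x : star (csub_val a) * e y = c *: e x ->
  hcoord (lact a v) y = c^* * hcoord v x.
Proof.
move=> ae; apply: hcoord_eq => /=.
by rewrite mulrA -[X in _ * X * _]starK -starM ae starZ -scalerAl hcoordE scalerA.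
Qed.

End Operators.

(** * Orthogonality of the Cuntz isometries *)

Section RootsOfUnity.
Variable R : realType.

(** A 2^r-th root of -1 has order dividing 2^(r+1) but not 2^r, hence exactly 2^(r+1). *)
Lemma dyadic_primitive_root r : exists z : R[i], (2 ^ r).-primitive_root z.
Proof.
case: r => [|r].
  have [m m1] := prim_order_exists (ltn0Sn 0) (expr1n R[i] 1).
  by rewrite dvdn1 => /eqP m1E; exists 1; rewrite expn0 -m1E.
have r0 : (0 < 2 ^ r)%N by rewrite expn_gt0.
pose z : R[i] := (2 ^ r).-root (-1); exists z.
have zr : z ^+ (2 ^ r) = -1 by exact: rootCK.
have zr1 : z ^+ (2 ^ r.+1) = 1 by rewrite expnS mulnC exprM zr sqrrN expr1n.
have [m mz] := prim_order_exists (expn_gt0 2 r.+1) zr1.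
move=> /(dvdn_pfactor _ _ (isT : prime 2))[k kr mk].
move: mz; rewrite mk; have [->//|kr'] := eqVneq k r.+1.
move=> /prim_expr_order zk.
have kler : (k <= r)%N by rewrite -ltnS ltn_neqAle kr' kr.
have : z ^+ (2 ^ r) = 1.
  by rewrite -(subnKC kler) expnD exprM zk expr1n.
by rewrite zr => /eqP; rewrite eqr_oppLR -subr_eq0 opprK -(natrD _ 1 1) pnatr_eq0.
Qed.

Lemma sum_prim_root (N k : nat) (z : R[i]) : N.-primitive_root z ->
  \sum_(j < N) (z ^+ k) ^+ j = if (N %| k)%N then N%:R else 0.
Proof.
move=> zN; have -> : (N %| k)%N = (z ^+ k == 1) by exact: prim_order_dvd.
have [->|zk] := eqVneq.
  by under eq_bigr do rewrite expr1n; rewrite sumr_const card_ord.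
have /eqP := subrX1 (z ^+ k) N.
rewrite exprAC (prim_expr_order zN) expr1n subrr eq_sym mulf_eq0 subr_eq0.
by rewrite (negbTE zk) => /eqP.
Qed.

End RootsOfUnity.

(** With a = 4 / N^2, Bernoulli gives (1 - a)^N >= 1 - 4 / N > 1/2, while (1 + a)^N (1 - a)^N <=
    1. *)
Lemma expr_square_lt2 (R : realType) (N : nat) : (8 < N)%N ->
  (1 + (2 / N%:R) ^+ 2) ^+ N < 2 :> R.
Proof.
move=> N8; have N0 : (0 : R) < N%:R by rewrite ltr0n (leq_trans _ N8).
pose a : R := (2 / N%:R) ^+ 2; rewrite -/a ltNge; apply/negP => ge2.
have a0 : 0 <= a by rewrite sqr_ge0.
have aN : a * N%:R = 4 / N%:R by rewrite /a; field; rewrite gt_eqF.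
have a1 : a <= 1.
  have N8R : (8 : R) < N%:R by rewrite ltr_nat.
  have : 2 / N%:R <= 1 :> R by rewrite ler_pdivrMr// mul1r; lra.
  by move=> N2; rewrite /a expr_le1// divr_ge0// ltW.
have bern k : 1 - a * k%:R <= (1 - a) ^+ k.
  elim: k => [|k IH]; first by rewrite mulr0 subr0 expr0.
  rewrite exprS; apply: le_trans (ler_wpM2l _ IH); last lra.
  rewrite -natr1; have : 0 <= a * a * k%:R by rewrite !mulr_ge0.
  lra.
have : (1 + a) ^+ N * (1 - a) ^+ N <= 1.
  rewrite -exprMn exprn_ile1//; nra.
have : 4 / N%:R < 2^-1 :> R.
  rewrite ltr_pdivrMr// ltr_pdivlMl//.
  by rewrite -natrM ltr_nat.
have := bern N; rewrite aN => *; nra.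
Qed.

(** * The unit as an extreme point of the unit ball *)

Section Extreme.
Variables (R : realType) (A : cstarType R).

(* The unit is an extreme point of the unit ball.  The norm of 1 + z h is at
   most 1 on both axes of the z-plane, hence at most 1 + |z|^2 |h|^2; a Cauchy
   estimate over the N-th roots of unity for (1 + z h)^N then bounds h. *)
Lemma unit_extreme (h : A) : star h = h -> cnorm (1 + h) <= 1 ->
  cnorm (1 - h) <= 1 -> h = 0.
Proof.
move=> hs h1 h2; have [/cnorm_eq0//|] := eqVneq (cnorm h) 0.
rewrite neq_lt ltNge cnorm_ge0/=; set eta := cnorm h => eta0.
have real (x : R) : -1 <= x -> x <= 1 -> cnorm (1 + x%:C *: h) <= 1.
  move=> x1 x2; pose a := (1 + x) / 2; pose b := (1 - x) / 2.
  have a0 : 0 <= a by rewrite /a; lra.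
  have b0 : 0 <= b by rewrite /b; lra.
  have ab : a + b = 1 by rewrite /a /b; field.
  have -> : 1 + x%:C *: h = a%:C *: (1 + h) + b%:C *: (1 - h).
    rewrite !scalerDr scalerN addrACA -scalerDl -scalerBl -rmorphD -rmorphB ab.
    by rewrite rmorph1 scale1r; congr (_ + _%:C *: _); rewrite /a /b; field.
  apply: le_trans (cnormD_le _ _) _; rewrite !cnormZc !normc_real// -ab.
  by apply: lerD; rewrite ler_piMr.
(* The C*-identity reduces this to [1 + u * u], the mean of [(1 + u) ^+ 2] and [(1 - u) ^+ 2], which
   the real case bounds. *)
have imag (y : R) : -1 <= y -> y <= 1 -> cnorm (1 + (y *i) *: h) <= 1.
  move=> y1 y2; pose u := y%:C *: h; pose w := (y *i) *: h.
  have yi2 : (y *i) * (y *i) = - (y%:C * y%:C) :> R[i].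
    by apply/eqP; rewrite eq_complex /=; apply/andP; split; apply/eqP; ring.
  have ww : w * w = - (u * u).
    by rewrite /w /u -!scalerAl -!scalerAr !scalerA yi2 scaleNr.
  have sw : star w = - w.
    rewrite /w starZ hs -scaleNr; congr (_ *: _).
    by apply/eqP; rewrite eq_complex /= oppr0 !eqxx.
  rewrite -(@expr_le1 _ 2) ?cnorm_ge0// -cnorm_starM -/w starD star1 sw.
  have -> : (1 - w) * (1 + w) = 2^-1%:C *: ((1 + u) ^+ 2 + (1 - u) ^+ 2).
    have -> : (1 + u) ^+ 2 + (1 - u) ^+ 2 = (2 : R)%:C *: (1 + u * u).
      have -> : (2 : R)%:C = 2%:R by rewrite rmorph_nat.
      have -> : (1 + u) ^+ 2 = 1 + u * u + u *+ 2.
        by rewrite addrC sqrrD1 expr2 addrAC [_ + 1]addrC.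
      have -> : (1 - u) ^+ 2 = 1 + u * u - u *+ 2.
        by rewrite -[1 - u]opprB sqrrN sqrrB1 expr2 addrAC [_ + 1]addrC.
      by rewrite addrACA subrr addr0 scaler_nat mulr2n.
    rewrite scalerA -rmorphM mulVf ?pnatr_eq0// rmorph1 scale1r.
    by rewrite mulrDr mulr1 mulrBl mul1r ww opprK addrA subrK.
  rewrite cnormZc normc_real ?invr_ge0// mulrC ler_pdivrMr// mul1r.
  apply: le_trans (cnormD_le _ _) _.
  have sq x : cnorm x <= 1 -> cnorm (x ^+ 2) <= 1 :> R.
    move=> x1; apply: le_trans (cnorm_expn _ _) _.
    by rewrite expr_le1// cnorm_ge0.
  apply: lerD; first exact/sq/real.
  rewrite -scaleNr -rmorphN; apply/sq/real; lra.
(* Split 1 + z h as (1 + u) (1 + w) - u w with u and w on the two axes. *)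
have disc (z : R[i]) : normc z <= 1 ->
    cnorm (1 + z *: h) <= 1 + normc z ^+ 2 * eta ^+ 2.
  move: z => [x y] z1; set t := normc _ in z1 *.
  have xt : `|x| <= t by have := normc_ge_Re (x +i* y); rewrite lecE => /andP[].
  have yt : `|y| <= t.
    rewrite /t /= -[`|y|]ger0_norm// -sqrtr_sqr ler_sqrt.
      by rewrite real_normK ?num_real// lerDr sqr_ge0.
    by rewrite addr_ge0 ?sqr_ge0.
  have := le_trans xt z1; have := le_trans yt z1.
  rewrite !ler_norml => /andP[y1 y2] /andP[x1 x2].
  pose u := x%:C *: h; pose w := (y *i) *: h.
  have -> : 1 + (x +i* y) *: h = (1 + u) * (1 + w) - u * w.
    rewrite mulrDl mul1r mulrDr mulr1 addrA addrK -addrA [w + u]addrC.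
    rewrite /u /w -scalerDl; congr (_ + _ *: _).
    by apply/eqP; rewrite eq_complex /= addr0 add0r !eqxx.
  apply: le_trans (cnormD_le _ _) _; rewrite cnormN; apply: lerD.
    apply: le_trans (cnormM_le _ _) _.
    by rewrite mulr_ile1 ?cnorm_ge0 ?real ?imag.
  apply: le_trans (cnormM_le _ _) _; rewrite !cnormZc mulrACA !expr2.
  rewrite ler_wpM2r ?mulr_ge0 ?cnorm_ge0// ler_pM ?normc_ge0//.
    by rewrite /= expr0n addr0 sqrtr_sqr.
  by rewrite /= expr0n add0r sqrtr_sqr.
have [r [r8 reta]] : exists r : nat, (8 < 2 ^ r)%N /\ 2 / eta <= (2 ^ r)%:R.
  pose s := maxn 4 (Num.bound (2 / eta)); exists s; split.
    by apply: leq_trans (_ : 2 ^ 4 <= _)%N => //; rewrite leq_pexp2l// leq_maxl.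
  have : 2 / eta < (Num.bound (2 / eta))%:R.
    by apply: archi_boundP; rewrite divr_ge0 ?ltW.
  move=> /ltW/le_trans; apply; rewrite ler_nat.
  apply: leq_trans (leq_maxr 4 _) _; exact/ltnW/ltn_expl.
have [zeta zetaP] := dyadic_primitive_root R r.
move: zetaP r8 reta; move: (2 ^ r)%N => N zetaP N8 Neta.
have N0 : (0 : R) < N%:R by rewrite ltr0n (leq_trans _ N8).
(* The radius with tau eta = 2 / N: the Cauchy estimate N tau eta <= (1 + (tau eta)^2)^N then reads
   2 <= (1 + 4 / N^2)^N. *)
pose tau := 2 / (eta * N%:R).
have tau0 : 0 < tau by rewrite divr_gt0// mulr_gt0.
have tau1 : tau <= 1.
  by rewrite ler_pdivrMr ?mulr_gt0// mul1r mulrC -ler_pdivrMr.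
have zeta1 k : normc (zeta ^+ k) = 1.
  rewrite normcX; have /eqP : normc zeta ^+ N = 1.
    by rewrite -normcX (prim_expr_order zetaP) normc1.
  by rewrite pexpr_eq1 ?normc_ge0// ?(ltn_trans _ N8)// => /eqP->; rewrite expr1n.
(* The weights are inverses of the [zeta ^+ j], so among the powers 0, ..., N of [h] only the linear
   one survives the sum. *)
pose S := \sum_(j < N) (zeta ^+ j) ^+ N.-1 *: (1 + (tau%:C * zeta ^+ j) *: h) ^+ N.
have SE : S = (N%:R * (tau%:C * N%:R)) *: h.
  pose G k := (N %| N.-1 + k)%N.
  have GE (k : 'I_N.+1) : G k = (k == 1 :> nat).
    rewrite /G; case: k => -[|[|k]] /= kN.
    - by rewrite addn0 gtnNdvd//; lia.
    - by rewrite addn1 prednK ?dvdnn//; lia.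
    - have -> : (N.-1 + k.+2 = N + k.+1)%N by lia.
      by rewrite dvdn_addr// gtnNdvd//; lia.
  pose c (k : nat) : R[i] := tau%:C ^+ k * 'C(N, k)%:R.
  transitivity (\sum_(j < N) \sum_(k < N.+1)
      ((zeta ^+ (N.-1 + k)) ^+ j * c k) *: h ^+ k).
    apply: eq_bigr => j _.
    rewrite exprDn_comm; last by rewrite /GRing.comm mul1r mulr1.
    rewrite scaler_sumr; apply: eq_bigr => k _.
    rewrite expr1n mul1r exprZn -scaler_nat !scalerA; congr (_ *: _).
    rewrite /c exprMn [zeta ^+ (_ + _)]exprD exprMn -!exprM.
    by rewrite ![(j * _)%N]mulnC; ring.
  rewrite exchange_big /=.
  under eq_bigr => k _ do
    rewrite -scaler_suml -mulr_suml (sum_prim_root _ zetaP) -/(G k) GE.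
  have N1 : (1 < N.+1)%N by rewrite ltnS (ltn_trans _ N8).
  rewrite (bigD1 (Ordinal N1))//= big1 ?addr0 => [|k].
    by rewrite /c expr1 bin1 expr1.
  by rewrite -val_eqE /= => /negbTE->; rewrite mul0r scale0r.
have Sle : cnorm S <= N%:R * (1 + (tau * eta) ^+ 2) ^+ N.
  have -> : N%:R * (1 + (tau * eta) ^+ 2) ^+ N =
      \sum_(j < N) (1 + (tau * eta) ^+ 2) ^+ N.
    by rewrite sumr_const card_ord mulr_natl.
  rewrite /S; elim/big_rec2: _ => [|j x y _ xy]; first by rewrite cnorm0.
  apply: le_trans (cnormD_le _ _) _; apply: lerD => //.
  rewrite cnormZc -exprM zeta1 mul1r; apply: le_trans (cnorm_expn _ _) _.
  apply: lerXn2r; rewrite ?nnegrE ?cnorm_ge0 ?addr_ge0 ?sqr_ge0//.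
  have zj : normc (tau%:C * zeta ^+ j) = tau.
    by rewrite normcM zeta1 mulr1 normc_real// ltW.
  by rewrite exprMn -{2}zj disc// zj.
have te : tau * eta = 2 / N%:R.
  by rewrite /tau; field; rewrite !gt_eqF.
have : 2 <= (1 + (2 / N%:R) ^+ 2) ^+ N :> R.
  have nN : normc (N%:R : R[i]) = N%:R.
    by rewrite -(rmorph_nat (real_complex R)) normc_real// ltW.
  move: Sle; rewrite SE cnormZc !normcM nN (normc_real (ltW tau0)) -/eta -mulrA.
  by rewrite ler_pM2l// mulrAC te divfK ?gt_eqF.
by rewrite leNgt expr_square_lt2.
Qed.

End Extreme.

Section CuntzOrtho.
Variables (R : realType) (A : cstarType R) (n : nat) (S : 'I_n -> A).
Hypothesis HS : cuntz_rel S.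

(** The compressions [c k] add up to 1 and [c j] is already 1, so the others should vanish. Instead
    of positivity, the bounds |1 - 2 c_k| <= 1 are used: they put 1 + h and 1 - h in the unit ball
    for h = 2 c_i / n, and extremality gives h = 0. *)
Lemma cuntz_ortho i j : i != j -> star (S i) * S j = 0.
Proof.
move=> ij; have [SS SSt] := HS.
pose c k := star (S j) * (S k * star (S k)) * S j.
have cs k : star (c k) = c k by rewrite /c !starM !starK !mulrA.
have Sn : cnorm (S j) = 1.
  apply/eqP; rewrite -(@eqrXn2 _ 2) ?cnorm_ge0// -cnorm_starM SS cnorm1.
  by rewrite expr1n.
(* 1 - 2 c k is the compression of the symmetry 1 - 2 S_k S_k^*. *)
have c_le k : cnorm (1 - c k *+ 2) <= 1.
  pose p := S k * star (S k); pose u := 1 - p *+ 2.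
  have pp : p * p = p by rewrite /p mulrA -[X in X * _ = _]mulrA SS mulr1.
  have us : star u = u by rewrite /u starB mulr2n starD star1 starM starK.
  have uu : u * u = 1.
    rewrite -expr2 /u -opprB sqrrN sqrrB1 expr2 mulrnAl mulrnAr pp.
    by rewrite subrr add0r.
  have un : cnorm u = 1.
    apply/eqP; rewrite -(@eqrXn2 _ 2) ?cnorm_ge0// -cnorm_starM us uu cnorm1.
    by rewrite expr1n.
  have -> : 1 - c k *+ 2 = star (S j) * u * S j.
    by rewrite /u mulrBr mulrBl mulr1 SS mulrnAr mulrnAl.
  apply: le_trans (cnormM_le _ _) _; rewrite Sn mulr1.
  by apply: le_trans (cnormM_le _ _) _; rewrite cnorm_star Sn mul1r un.
have cj : c j = 1 by rewrite /c !mulrA SS mul1r SS.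
have call : \sum_k c k = 1 by rewrite -mulr_suml -mulr_sumr SSt mulr1 SS.
have n0 : (0 < n)%N by exact: leq_ltn_trans (ltn_ord i).
have nR : (0 : R) < n%:R by rewrite ltr0n.
have ci : c i = 0.
  pose a : R[i] := (n%:R^-1)%:C; pose h := a *: (c i *+ 2).
  have an : a * n%:R = 1.
    by rewrite /a -(rmorph_nat (real_complex R)) -rmorphM mulVf ?gt_eqF.
  have nora : normc a = n%:R^-1 by rewrite normc_real// invr_ge0 ltW.
  have scale x : cnorm (n%:R *: 1 + x) <= n%:R -> cnorm (1 + a *: x) <= 1.
    have -> : 1 + a *: x = a *: (n%:R *: 1 + x).
      by rewrite scalerDr scalerA an scale1r.
    by move=> nx; rewrite cnormZc nora mulrC ler_pdivrMr ?mul1r.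
  have h0 : h = 0.
    apply: unit_extreme.
    - rewrite /h starZ mulr2n starD cs; congr (_ *: _).
      by apply/eqP; rewrite eq_complex /= oppr0 !eqxx.
    - apply: scale.
      (* Because the [c k] sum to 1 and [c j = 1], n + 2 c_i equals 2 plus n - 2 terms of norm at
         most 1. *)
      pose rest := \sum_(k | (k != j) && (k != i)) (1 - c k *+ 2).
      have restE : n%:R *: 1 + c i *+ 2 = 2%:R *: 1 + rest.
        have : \sum_k (1 - c k *+ 2) = n%:R *: 1 - 2%:R *: 1.
          rewrite sumrB sumr_const card_ord !scaler_nat; congr (_ - _).
          by rewrite sumrMnl call.
        rewrite (bigD1 j)//= (bigD1 i)//= -/rest cj => /eqP.
        rewrite eq_sym subr_eq => /eqP ->; rewrite !scaler_nat.
        rewrite [1 - 1 *+ 2 + _]addrC [_ + (1 - _)]addrA subrK addrAC.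
        by rewrite [_ + rest + _]addrAC subrK addrAC mulr2n.
      have : \sum_(k < n) (1 : R) = n%:R by rewrite sumr_const card_ord.
      rewrite (bigD1 j)//= (bigD1 i)//= restE => <-.
      apply: le_trans (cnormD_le _ _) _; rewrite cnorm_scalar.
      rewrite -(rmorph_nat (real_complex R)) normc_real// addrA.
      apply: lerD; first by rewrite lexx.
      rewrite /rest; elim/big_rec2: _ => [|k x y _ xy]; first by rewrite cnorm0.
      by apply: le_trans (cnormD_le _ _) _; exact: lerD.
    - rewrite -scalerN; apply: scale.
      have -> : n%:R *: 1 - c i *+ 2 = n.-1%:R *: 1 + (1 - c i *+ 2).
        by rewrite [RHS]addrA !scaler_nat -mulrSr prednK.
      apply: le_trans (cnormD_le _ _) _; rewrite cnorm_scalar.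
      rewrite -(rmorph_nat (real_complex R)) normc_real ?ler0n//.
      by rewrite -[n in leRHS](prednK n0) -natr1 lerD2l.
  have : n%:R *: h = 0 by rewrite h0 scaler0.
  rewrite /h scalerA mulrC an scale1r -scaler_nat => /eqP.
  by rewrite scaler_eq0 pnatr_eq0 /= => /eqP.
apply: cnorm_eq0; apply/eqP; rewrite -sqrf_eq0 -cnorm_starM starM starK.
by rewrite mulrA -[star (S j) * _ * _]mulrA -/(c i) ci cnorm0.
Qed.

End CuntzOrtho.

(** * A representation of the Cuntz algebra containing Fock space *)

(** [t] is the identity on the range of [p] and [s] on its complement; [star s * p = 0] keeps the
    two images orthogonal. *)
Lemma fix_isometry (R : realType) (A : cstarType R) (s p : A) :
  star s * s = 1 -> p * p = p -> star p = p -> star s * p = 0 ->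
  let t := p + s * (1 - p) in
  star t * t = 1 /\ t * star t = p + s * (1 - p) * star s.
Proof.
move=> ss pp ps sp /=; have ps0 : p * s = 0.
  by rewrite -[LHS]starK starM ps sp star0.
have p0 : p * (1 - p) = 0 by rewrite mulrBr mulr1 pp subrr.
have p0' : (1 - p) * p = 0 by rewrite mulrBl mul1r pp subrr.
have pp' : (1 - p) * (1 - p) = 1 - p by rewrite mulrBl mul1r p0 subr0.
have us : star (1 - p) = 1 - p by rewrite starB star1 ps.
have pu : p + (1 - p) = 1 by rewrite addrC subrK.
move: (1 - p) p0 p0' pp' us pu => u p0 p0' pp' us pu.
rewrite starD [star (s * _)]starM us ps; split.
  rewrite mulrDl !mulrDr pp !mulrA ps0 mul0r addr0 -[_ * star s * p]mulrA sp.
  by rewrite mulr0 add0r -[_ * star s * s]mulrA ss mulr1 pp'.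
rewrite mulrDl !mulrDr pp !mulrA p0 mul0r addr0 -[s * _ * p]mulrA p0' mulr0.
by rewrite add0r -[s * _ * _]mulrA pp'.
Qed.

Section FixedVector.
Variables (R : realType) (A : cstarType R) (n : nat) (hn : (2 <= n)%N).
Variable S : 'I_n -> A.
Hypothesis HS : cuntz_rel S.

Lemma n_gt0 : (0 < n)%N. Proof. exact: ltnW. Qed.

Let i0 : 'I_n := Ordinal n_gt0.
Let i1 : 'I_n := Ordinal hn.
Let q := S i0 * star (S i0).

(* A Cuntz family whose first isometry fixes the vector S i0. *)
Definition cuntz_fix (i : 'I_n) : A :=
  if i == i0 then q + S i1 * (1 - q)
  else if i == i1 then S i1 * S i0 else S i.
Local Notation T := cuntz_fix.

Let SS i : star (S i) * S i = 1. Proof. exact: HS.1. Qed.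
Let qq : q * q = q.
Proof. by rewrite /q mulrA -[X in X * _ = _]mulrA SS mulr1. Qed.
Let qs : star q = q. Proof. by rewrite /q starM starK. Qed.
Let S1q : star (S i1) * q = 0.
Proof. by rewrite /q mulrA (cuntz_ortho HS)// mul0r. Qed.
Let qS1 : q * S i1 = 0.
Proof. by rewrite -[LHS]starK starM qs S1q star0. Qed.

Let T0 : T i0 = q + S i1 * (1 - q). Proof. by rewrite /T eqxx. Qed.
Let T1 : T i1 = S i1 * S i0. Proof. by rewrite /T eqxx. Qed.
(** Only the ranges of the letters [i0] and [i1] are regrouped: q + S1 (1 - q) S1^* and S1 q S1^*
    add up to S0 S0^* + S1 S1^*. *)
Lemma cuntz_fix_rel : cuntz_rel T.
Proof.
have /= [TT TTt] := fix_isometry (SS i1) qq qs S1q.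
split=> [i|].
  have [->|i0i] := eqVneq i i0; first by rewrite T0.
  have [->|i1i] := eqVneq i i1.
    by rewrite T1 starM -mulrA [star (S i1) * _]mulrA SS mul1r SS.
  by rewrite /T (negbTE i0i) (negbTE i1i) SS.
transitivity (\sum_i S i * star (S i)); last exact: HS.2.
rewrite (bigD1 i0)//= (bigD1 i1)//= T0 T1 [star (S i1 * _)]starM [RHS](bigD1 i0)//=.
rewrite [in RHS](bigD1 i1)//= [LHS]addrA [RHS]addrA; congr (_ + _); last first.
  by apply: eq_bigr => i /andP[i00 i11]; rewrite /T (negbTE i00) (negbTE i11).
rewrite TTt -[_ * (star _ * _)]mulrA [S i0 * (_ * _)]mulrA -/q.
by rewrite -[q + _ + _]addrA -mulrA -mulrDr -mulrDl subrK mul1r.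
Qed.

Lemma cuntz_fix0 : T i0 * S i0 = S i0.
Proof.
rewrite T0 mulrDl -[_ * _ * S i0]mulrA mulrBl mul1r /q -mulrA SS mulr1.
by rewrite subrr mulr0 addr0.
Qed.

Definition digit x : 'I_n := Ordinal (ltn_pmod x n_gt0).

Lemma digitE (i : 'I_n) x : digit (n * x + i)%N = i.
Proof. by apply: val_inj; rewrite /= mulnC modnMDl modn_small. Qed.

Lemma quotE (i : 'I_n) x : ((n * x + i) %/ n)%N = x.
Proof. by rewrite mulnC divnMDl ?n_gt0// divn_small// addn0. Qed.

Lemma digitK x : (n * (x %/ n) + digit x)%N = x.
Proof. by rewrite mulnC -divn_eq. Qed.

(* Leading zero digits of x are harmless because T i0 fixes S i0. *)
Fixpoint digit_basis_rec k x : A :=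
  if k is k'.+1 then T (digit x) * digit_basis_rec k' (x %/ n)%N else S i0.
Definition digit_basis x := digit_basis_rec x x.

Lemma digit_basis_rec0 k : digit_basis_rec k 0 = S i0.
Proof.
elim: k => //= k IH; rewrite div0n IH.
have -> : digit 0 = i0 by apply: val_inj; rewrite /= mod0n.
exact: cuntz_fix0.
Qed.

Lemma digit_basis_recE k x : (x <= k)%N -> digit_basis_rec k x = digit_basis x.
Proof.
rewrite /digit_basis; have [m] := ubnP x; elim: m k x => // m IH [|k] [|x] //.
- by move=> _ _; rewrite !digit_basis_rec0.
- rewrite !ltnS => xm xk /=.
  have xn : (x.+1 %/ n <= x)%N by rewrite -ltnS ltn_Pdiv.
  rewrite !IH//; try lia.
Qed.

Lemma digit_basisE x : digit_basis x = T (digit x) * digit_basis (x %/ n)%N.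
Proof.
case: x => [|x].
  by have /= := digit_basis_rec0 1; rewrite div0n.
by rewrite {1}/digit_basis /= digit_basis_recE// -ltnS ltn_Pdiv.
Qed.

Lemma mul_digit_basis i x : T i * digit_basis x = digit_basis (n * x + i)%N.
Proof. by rewrite [RHS]digit_basisE digitE quotE. Qed.

Lemma star_mul_digit_basis i x :
  star (T i) * digit_basis x = (i == digit x)%:R *: digit_basis (x %/ n)%N.
Proof.
rewrite digit_basisE mulrA; case: eqVneq => [->|ij].
  by rewrite cuntz_fix_rel.1 mul1r scale1r.
by rewrite (cuntz_ortho cuntz_fix_rel ij) mul0r scale0r.
Qed.

Lemma digit_basis_ortho x y : star (digit_basis x) * digit_basis y = (x == y)%:R.
Proof.
have [m] := ubnP (x + y)%N; elim: m x y => // m IH x y xym.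
(* The one pair that division by n does not make smaller. *)
have [/eqP|xy0] := eqVneq (x + y)%N 0%N.
  by rewrite addn_eq0 => /andP[/eqP-> /eqP->]; rewrite /digit_basis /= SS.
have xyE : (x == y) = (digit x == digit y) && ((x %/ n)%N == (y %/ n)%N).
  apply/eqP/andP => [->//|[/eqP dxy /eqP qxy]].
  by rewrite -(digitK x) -(digitK y) dxy qxy.
rewrite [in LHS]digit_basisE starM -mulrA star_mul_digit_basis -scalerAr xyE.
case: (digit x == digit y); last by rewrite scale0r.
rewrite scale1r IH//; apply: leq_trans (_ : x + y <= _)%N; last by rewrite -ltnS.
have := leq_divDl x y n.
have xle : (x %/ n <= x)%N by exact: leq_div.
have yle : (y %/ n <= y)%N by exact: leq_div.
have [x0|x0] := posnP x.
  rewrite x0 div0n !add0n => _; apply: ltn_Pdiv => //.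
  by move: xy0; rewrite x0 lt0n.
move=> _; rewrite -addSn leq_add//; exact: ltn_Pdiv.
Qed.

End FixedVector.

(** * Words coded by numbers, and partial injections of words *)

Section Words.
Variables (n : nat) (hn : (2 <= n)%N).
Local Notation word := (seq 'I_n).
Local Notation digit := (digit hn).

(* The basis vectors indexed by word_code s span a Fock space with vacuum 1: the
   digits of s are followed by the leading digit 1.  Starting from 0 instead
   would not separate words, as x |-> n x + i0 fixes 0. *)
Fixpoint word_code (s : word) : nat := if s is i :: s' then (n * word_code s' + i)%N else 1%N.

Lemma word_code_gt0 s : (0 < word_code s)%N.
Proof. by elim: s => //= i s IH; rewrite addn_gt0 muln_gt0 IH (ltnW hn). Qed.

Lemma word_code_cons_ge2 i s : (2 <= word_code (i :: s))%N.
Proof. by have := word_code_gt0 s => /=; nia. Qed.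

Lemma word_code_inj : injective word_code.
Proof.
elim=> [|i s IH] [|j t]//.
- by have := word_code_cons_ge2 j t => /[swap] <-.
- by have := word_code_cons_ge2 i s => /[swap] ->.
move=> /= E; have /(congr1 (divn^~ n)) := E.
rewrite !quotE// => /IH ->; have /(congr1 digit) := E.
by rewrite !digitE => ->.
Qed.

Definition word_decode (x : nat) : option word :=
  if pselect (exists s, word_code s = x) is left ex then Some (sval (cid ex))
  else None.

Lemma word_codeK : pcancel word_code word_decode.
Proof.
move=> s; rewrite /word_decode; case: pselect => [ex|[]]; last by exists s.
by case: cid => t /= /word_code_inj ->.
Qed.

Lemma word_decodeP x s : word_decode x = Some s <-> word_code s = x.
Proof.
split=> [|<-]; last exact: word_codeK.
by rewrite /word_decode; case: pselect => // ex [<-]; case: cid.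
Qed.

(** Positivity of [x] matters: n * 0 + 1 is the code of the empty word, whereas 0 is not a code. *)
Lemma word_decode_cons (i : 'I_n) x : (0 < x)%N ->
  word_decode (n * x + i)%N = omap (cons i) (word_decode x).
Proof.
move=> x0; case dx: (word_decode x) => [s|] /=.
  by apply/word_decodeP; move/word_decodeP: dx => /= ->.
case dy: (word_decode _) => [[|j s]|]//; move/word_decodeP: dy => /=.
  by nia.
move=> E; have /(congr1 (divn^~ n)) := E.
by rewrite !quotE// => /word_decodeP; rewrite dx.
Qed.

Lemma word_decode_digit y : (n <= y)%N ->
  word_decode y = omap (cons (digit y)) (word_decode (y %/ n)%N).
Proof.
move=> ny; rewrite -word_decode_cons ?digitK// divn_gt0//; exact: ltnW.
Qed.

Definition word_inj (w w' : word -> option word) :=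
  forall s t, w' s = Some t <-> w t = Some s.

(** Undefined on numbers that are not codes, so the resulting operators vanish on the orthogonal
    complement of the Fock space. *)
Definition word_code_shift (w : word -> option word) (x : nat) : option nat :=
  obind (fun s => omap word_code (w s)) (word_decode x).

Lemma word_code_shift_inj w w' : word_inj w w' -> partial_inj (word_code_shift w).
Proof.
move=> ww; exists (word_code_shift w').
have half u u' : word_inj u u' -> forall x y,
    word_code_shift u' x = Some y -> word_code_shift u y = Some x.
  move=> uu x y; rewrite /word_code_shift; case dx: (word_decode x) => [s|]//=.
  case us: (u' s) => [t|]//= [<-]; rewrite word_codeK /=.
  by move/uu: us => ->/=; congr Some; apply/word_decodeP.
by move=> x y; split; apply: half => // s t; split; move/ww.
Qed.

Definition keep_parity d (s : word) : option word :=
  if odd (size s) == d then Some s else None.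
(** The isometries [cuntz_fix] act at the head of a word; operations at its end therefore commute
    with them except on very short words. *)
Definition add_last (i : 'I_n) (s : word) : option word := Some (rcons s i).
Definition drop_last (i : 'I_n) (s : word) : option word :=
  if s is j :: s' then
    if last j s' == i then Some (belast j s') else None
  else None.
Definition keep_nil (s : word) : option word := if nilp s then Some s else None.

Lemma drop_last_rcons i j s :
  drop_last i (rcons s j) = if j == i then Some s else None.
Proof.
by case: s => [|k s] //=; rewrite last_rcons belast_rcons.
Qed.

Lemma keep_parity_rcons d s i :
  keep_parity (~~ d) (rcons s i) = omap (rcons^~ i) (keep_parity d s).
Proof.
by rewrite /keep_parity size_rcons /= eqb_negLR negbK; case: ifP.
Qed.

Lemma keep_parity_cons d s i :
  keep_parity (~~ d) (i :: s) = omap (cons i) (keep_parity d s).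
Proof. by rewrite /keep_parity /= eqb_negLR negbK; case: ifP. Qed.

Lemma drop_last_cons i j s : s != [::] ->
  drop_last i (j :: s) = omap (cons j) (drop_last i s).
Proof.
case/lastP: s => // s k _; rewrite -rcons_cons !drop_last_rcons.
by case: eqP.
Qed.

Lemma keep_parity_inj d : word_inj (keep_parity d) (keep_parity d).
Proof.
by move=> s t; rewrite /keep_parity; split; case: ifP => // od [<-]; rewrite od.
Qed.

Lemma add_last_inj i : word_inj (add_last i) (drop_last i).
Proof.
move=> s t; split; last by move=> [<-]; rewrite drop_last_rcons eqxx.
case/lastP: s => // s j; rewrite drop_last_rcons; case: eqP => // -> [->].
by [].
Qed.

Lemma drop_last_inj i : word_inj (drop_last i) (add_last i).
Proof. by move=> s t; have := add_last_inj i t s; tauto. Qed.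

Lemma keep_nil_inj : word_inj keep_nil keep_nil.
Proof. by move=> [|? ?] [|? ?]; rewrite /keep_nil; split. Qed.

End Words.

(** * Operators on the Fock space *)

Section Fock.
Variables (R : realType) (A : cstarType R) (n : nat) (hn : (2 <= n)%N).
Variable S : 'I_n -> A.
Hypothesis HS : cuntz_rel S.

Local Notation T := (cuntz_fix hn S).
Local Notation e := (digit_basis hn S).
Let ortho := digit_basis_ortho hn HS.
Local Notation H := (hspace e).
Local Notation hcoord := (hcoord ortho).

Definition word_op (w w' : seq 'I_n -> option (seq 'I_n)) (h : word_inj w w') : endo H :=
  hshift ortho (word_code_shift_inj hn h).

Lemma word_opE w w' (h : word_inj w w') v y : hcoord (word_op h v) y =
  if word_decode n y is Some s then
    if w s is Some t then hcoord v (word_code t) else 0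
  else 0.
Proof.
rewrite hshiftE /word_code_shift; case: (word_decode n y) => //= s.
by case: (w s).
Qed.

Lemma word_op_code w w' (h : word_inj w w') v s : hcoord (word_op h v) (word_code s) =
  if w s is Some t then hcoord v (word_code t) else 0.
Proof. by rewrite word_opE word_codeK. Qed.

(* A partial map of words acts by pulling back coordinates, so the operator that
   appends a letter comes from the map that drops it. *)
Definition parity_op d := word_op (@keep_parity_inj n d).
Definition creation i := word_op (@drop_last_inj n i).
Definition annihilation i := word_op (@add_last_inj n i).
Definition vacuum := word_op (@keep_nil_inj n).

Lemma parity_op_idem d : parity_op d * parity_op d = parity_op d.
Proof.
apply: (endo_hcoordP (ortho := ortho)) => v y; rewrite !word_opE.
case: (word_decode n y) => // s; case ks: (keep_parity d s) => [t|//].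
move: ks; rewrite /keep_parity; case: ifP => // ds [<-].
by rewrite word_op_code /keep_parity ds.
Qed.

(** Creation and annihilation vanish off the Fock space, so the relation needs a parity projection
    on the right. *)
Lemma annihilation_creation d i j :
  annihilation i * creation j * parity_op d = if i == j then parity_op d else 0.
Proof.
apply: (endo_hcoordP (ortho := ortho)) => v y; rewrite !endoM word_opE.
transitivity (if i == j then hcoord (parity_op d v) y else 0); last first.
  by case: eqVneq => // _; rewrite hcoord0.
rewrite [in RHS]word_opE; case: (word_decode n y) => [s|]; last by case: eqP.
rewrite /add_last word_op_code drop_last_rcons eq_sym; case: eqP => // _.
by rewrite word_op_code.
Qed.

Lemma parity_creation d i : parity_op (~~ d) * creation i = creation i * parity_op d.
Proof.
apply: (endo_hcoordP (ortho := ortho)) => v y; rewrite !word_opE.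
case: (word_decode n y) => // s; case/lastP: s => [|s j].
  rewrite [drop_last _ _]/=; case ks: (keep_parity _ _) => [t|] //.
  move: ks; rewrite /keep_parity; case: ifP => // _ [<-].
  by rewrite word_op_code.
rewrite drop_last_rcons keep_parity_rcons.
case ks: (keep_parity d s) => [t|]; last first.
  by case: eqP => // _; rewrite word_op_code ks.
have -> : t = s by move: ks; rewrite /keep_parity; case: ifP => // _ [].
rewrite -[LHS]/(hcoord (creation i v) (word_code (rcons s j))).
rewrite word_op_code drop_last_rcons; case: eqP => // _.
rewrite word_op_code ks; move: ks; rewrite /keep_parity.
by case: ifP => // _ [->].
Qed.

Lemma hcoordD v w y : hcoord (v + w) y = hcoord v y + hcoord w y.
Proof. by rewrite -[v]scale1r hcoordP mul1r scale1r. Qed.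

(** A nonempty word is, in exactly one way, a word of opposite parity followed by a letter; the
    empty word is even. *)
Lemma parity_op_dec d : parity_op d = (if d then 0 else vacuum) +
  \sum_i creation i * parity_op (~~ d) * annihilation i.
Proof.
apply: (endo_hcoordP (ortho := ortho)) => v y.
rewrite endoD hcoordD endo_sum hcoord_sum.
have vacE : hcoord ((if d then 0 else vacuum) v) y = if word_decode n y is Some s then
    (if ~~ d && nilp s then hcoord v (word_code s) else 0) else 0.
  case: d => [|].
    by rewrite -[X in hcoord X]/(0 : H) hcoord0; case: (word_decode n y).
  rewrite word_opE; case: (word_decode n y) => // s.
  by rewrite /keep_nil; case: ifP.
rewrite vacE word_opE.
under eq_bigr => i _ do rewrite !endoM word_opE.
case: (word_decode n y) => [s|]; last by rewrite big1 ?addr0.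
case/lastP: s => [|s j].
  rewrite [X in _ + X]big1 ?addr0 => [|i _]; last by [].
  by rewrite andbT /keep_parity; case: d {vacE}.
have -> : nilp (rcons s j) = false by rewrite /nilp size_rcons.
rewrite andbF add0r (bigD1 j)//= [X in _ + X]big1 ?addr0 => [|i ij]; last first.
  by rewrite drop_last_rcons eq_sym (negbTE ij).
rewrite drop_last_rcons eqxx word_op_code -[d in LHS]negbK keep_parity_rcons.
case ks: (keep_parity _ s) => [t|] //=.
by rewrite word_op_code.
Qed.

Lemma vacuum_trace : has_trace vacuum 1.
Proof.
(* Two coordinates suffice: the vacuum is the basis vector with index 1. *)
have := @has_trace_coord _ _ _ ortho 2 vacuum.
rewrite big_ord_recl big_ord1.
have -> : hcoord (vacuum (evec e 0%N)) 0%N = 0.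
  rewrite word_opE; case ds: (word_decode n 0) => [s|//].
  by move/(word_decodeP hn): ds; have := word_code_gt0 hn s; case: word_code.
have -> : hcoord (vacuum (evec e 1%N)) 1%N = 1.
  rewrite -[LHS]/(hcoord (vacuum (evec e 1%N)) (word_code ([::] : seq 'I_n))).
  by rewrite word_op_code; exact: (hcoord_evec ortho 1 1).
rewrite add0r; apply => v y y2; rewrite word_opE.
case ds: (word_decode n y) => [[|i s]|//]; last by [].
by move/(word_decodeP hn): ds y2 => <-.
Qed.

End Fock.

Arguments lact : simpl never.
Arguments word_op : simpl never.

(** * Even and odd elements, and commutation up to finite rank *)

Section AlmostCommuting.
Variables (R : realType) (A : cstarType R) (n : nat) (hn : (2 <= n)%N).
Variable S : 'I_n -> A.
Hypothesis HS : cuntz_rel S.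

Local Notation T := (cuntz_fix hn S).
Local Notation e := (digit_basis hn S).
Let ortho := digit_basis_ortho hn HS.
Local Notation H := (hspace e).
Local Notation hcoord := (hcoord ortho).
Local Notation M := (stab e).
Local Notation P := (parity_op hn HS).
Local Notation C := (creation hn HS).

Lemma endoB (f g : endo H) v : (f - g) v = f v - g v. Proof. by []. Qed.

Lemma cuntz_fix_stab i : stabilizer e (T i).
Proof.
move=> v sv; split; apply: in_spanM sv => x.
  by rewrite mul_digit_basis//; exact: (hvalP (evec e _)).
rewrite star_mul_digit_basis// -[_ *: _]addr0; apply: in_span_linear.
  exact: (hvalP (evec e _)).
exact: in_span0.
Qed.

Definition fock_gen i : M := csub_mk (stabilizer_closed e) (cuntz_fix_stab i).

Lemma fock_gen_rel : cuntz_rel fock_gen.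
Proof.
have [TT TTt] := cuntz_fix_rel hn HS.
split=> [i|]; apply: val_inj; first exact: TT.
by rewrite /= csub_val_sum.
Qed.

Lemma hcoord_gen i v y : hcoord (lact (fock_gen i) v) y =
  (i == digit hn y)%:R * hcoord v (y %/ n)%N.
Proof.
rewrite (@hcoord_lact _ _ _ ortho _ v y (i == digit hn y)%:R (y %/ n)%N).
  by case: eqP => _; rewrite ?rmorph1 ?rmorph0.
exact: star_mul_digit_basis.
Qed.

Lemma hcoord_star_gen i v y : hcoord (lact (star (fock_gen i)) v) y =
  hcoord v (n * y + i)%N.
Proof.
rewrite (@hcoord_lact _ _ _ ortho _ v y 1 (n * y + i)%N).
  by rewrite rmorph1 mul1r.
by rewrite /= starK scale1r mul_digit_basis.
Qed.

Section Intertwine.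
Variables (w w' u u' : seq 'I_n -> option (seq 'I_n)).
Variables (hw : word_inj w w') (hu : word_inj u u').
Hypothesis wu : forall i s, s != [::] -> w (i :: s) = omap (cons i) (u s).

(** By [wu], [w] acts as [u] behind the first letter, except perhaps on words of at most one letter.
    Their codes are below 2 n, so the difference has only finitely many nonzero coordinates. *)
Lemma gen_intertwine i : finite_rank
  (lact (fock_gen i) * word_op hn HS hu - word_op hn HS hw * lact (fock_gen i)).
Proof.
eexists; apply: (has_trace_coord (ortho := ortho) (N := n.*2)) => v y y2.
rewrite endoB hcoordB !endoM hcoord_gen !word_opE.
have ny : (n <= y)%N by lia.
have q2 : (2 <= y %/ n)%N by rewrite leq_divRL ?(ltnW hn)// mul2n.
rewrite (word_decode_digit hn ny); case ds: (word_decode n _) => [s|] /=; last first.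
  by rewrite mulr0 subrr.
have s0 : s != [::] by apply: contraTneq q2 => s0; move/(word_decodeP hn): ds; rewrite s0 => <-.
rewrite wu//; case: (u s) => [t|]; last by rewrite mulr0 subrr.
rewrite /= hcoord_gen -[(y %% n)%N]/(nat_of_ord (digit hn y)).
by rewrite digitE quotE// subrr.
Qed.

Lemma star_gen_intertwine i : finite_rank
  (lact (star (fock_gen i)) * word_op hn HS hw -
   word_op hn HS hu * lact (star (fock_gen i))).
Proof.
eexists; apply: (has_trace_coord (ortho := ortho) (N := 2)) => v y y2.
rewrite endoB hcoordB !endoM hcoord_star_gen !word_opE word_decode_cons ?(ltnW y2)//.
case ds: (word_decode n _) => [s|] /=; last by rewrite subrr.
have s0 : s != [::] by apply: contraTneq y2 => s0; move/(word_decodeP hn): ds; rewrite s0 => <-.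
rewrite wu//; case: (u s) => [t|]; last by rewrite subrr.
by rewrite /= hcoord_star_gen subrr.
Qed.

End Intertwine.

Definition almost_graded c (b : M) :=
  (forall d, finite_rank (lact b * P d - P (d (+) c) * lact b)) /\
  (forall i, finite_rank (lact b * C i - C i * lact b)).

Definition star_graded c b := almost_graded c b /\ almost_graded c (star b).

Lemma almost_gradedM c c' a b : almost_graded c a -> almost_graded c' b ->
  almost_graded (c (+) c') (a * b).
Proof.
move=> [aP aC] [bP bC]; split=> [d|i]; rewrite lactM.
- have -> : lact a * lact b * P d - P (d (+) (c (+) c')) * (lact a * lact b) =
    lact a * (lact b * P d - P (d (+) c') * lact b) +
    (lact a * P (d (+) c') - P (d (+) c' (+) c) * lact a) * lact b.
    by rewrite mulrBr mulrBl !mulrA addrA subrK -addbA [c' (+) c]addbC.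
  by apply: finite_rankD; [exact: finite_rankMl|exact: finite_rankMr].
- have -> : lact a * lact b * C i - C i * (lact a * lact b) =
    lact a * (lact b * C i - C i * lact b) + (lact a * C i - C i * lact a) * lact b.
    by rewrite mulrBr mulrBl !mulrA addrA subrK.
  by apply: finite_rankD; [exact: finite_rankMl|exact: finite_rankMr].
Qed.

Lemma lactD a b : lact (a + b) = lact a + lact b :> endo H.
Proof. by apply/endoP => v; apply: val_inj; exact: mulrDl. Qed.

Lemma almost_gradedD c a b : almost_graded c a -> almost_graded c b ->
  almost_graded c (a + b).
Proof.
have split4 (x y z t : endo H) : x + y - (z + t) = (x - z) + (y - t).
  by rewrite opprD addrACA.
move=> [aP aC] [bP bC]; split=> [d|i];
  rewrite lactD mulrDl mulrDr split4; exact: finite_rankD.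
Qed.

Lemma almost_graded_scalar (c : R[i]) : almost_graded false (c *: 1).
Proof.
have cE v : lact (c *: 1 : M) v = c *: v.
  by rewrite -[c *: 1]addr0 lactP lact1; apply: val_inj; rewrite /= mul0r addr0.
have comm (f : endo H) : lact (c *: 1) * f = f * lact (c *: 1).
  by apply/endoP => v; rewrite !endoM !cE linearZ.
split=> [d|i]; rewrite comm ?addbF subrr; exact: finite_rank0.
Qed.

Lemma star_graded_gen i : star_graded true (fock_gen i).
Proof.
have P_cons d j (s : seq 'I_n) : s != [::] ->
    keep_parity (~~ d) (j :: s) = omap (cons j) (keep_parity d s).
  by move=> _; exact: keep_parity_cons.
split; split=> [d|k].
- by rewrite addbT; exact/gen_intertwine/P_cons.
- by apply: gen_intertwine => j s; exact: drop_last_cons.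
- have := @star_gen_intertwine _ _ _ _ (@keep_parity_inj n d)
    (@keep_parity_inj n (~~ d)).
  by rewrite addbT; apply=> j s s0; rewrite -[d in LHS]negbK P_cons.
- by apply: star_gen_intertwine => j s; exact: drop_last_cons.
Qed.

(** The second coordinate imitates the image of the first under the sign change of the generators.
    Half the sum and half the difference recover the even and odd parts without any such
    automorphism of [M]. *)
Definition graded_pair (z : (M * M)%type) := exists b0 b1,
  [/\ star_graded false b0, star_graded true b1 & z = (b0 + b1, b0 - b1)].

Lemma star_gradedM c c' a b : star_graded c a -> star_graded c' b ->
  star_graded (c (+) c') (a * b).
Proof.
move=> [a1 a2] [b1 b2]; split; first exact: almost_gradedM.
by rewrite starM addbC; exact: almost_gradedM.
Qed.

Lemma star_gradedD c a b : star_graded c a -> star_graded c b ->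
  star_graded c (a + b).
Proof.
move=> [a1 a2] [b1 b2]; split; first exact: almost_gradedD.
by rewrite starD; exact: almost_gradedD.
Qed.

Lemma star_graded_scalar (c : R[i]) : star_graded false (c *: 1).
Proof.
by split; rewrite ?starZ ?star1; exact: almost_graded_scalar.
Qed.

Lemma graded_pairM x y : graded_pair x -> graded_pair y -> graded_pair (x * y).
Proof.
move=> [a0 [a1 [ga0 ga1 ->]]] [b0 [b1 [gb0 gb1 ->]]].
exists (a0 * b0 + a1 * b1), (a0 * b1 + a1 * b0); split.
- by apply: star_gradedD; [exact: (star_gradedM ga0 gb0)|exact: (star_gradedM ga1 gb1)].
- by apply: star_gradedD; [exact: (star_gradedM ga0 gb1)|exact: (star_gradedM ga1 gb0)].
congr (_, _).
  by rewrite mulrDl !mulrDr [a1 * b0 + _]addrC addrACA.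
by rewrite mulrBl !mulrBr opprB addrACA -opprD.
Qed.

Lemma graded_pairP (c : R[i]) x y :
  graded_pair x -> graded_pair y -> graded_pair (c *: x + y).
Proof.
move=> gx gy.
have {gx} [a0 [a1 [ga0 ga1 ->]]] : graded_pair (c *: x).
  have -> : c *: x = (c *: 1 : (M * M)%type) * x by rewrite -scalerAl mul1r.
  apply: graded_pairM => //; exists (c *: 1), 0; split.
  - exact: star_graded_scalar.
  (* Zero counts as odd: it is an odd generator times the even scalar 0. *)
  - rewrite -[0](mulr0 (fock_gen (Ordinal hn))) -(scale0r 1).
    exact: (star_gradedM (star_graded_gen _) (star_graded_scalar 0)).
  - by rewrite subr0 addr0.
have [b0 [b1 [gb0 gb1 ->]]] := gy.
exists (a0 + b0), (a1 + b1); split; [exact: star_gradedD..|].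
by congr (_, _); rewrite ?opprD /= addrACA.
Qed.

Lemma graded_pair_star x : graded_pair x -> graded_pair (star x).
Proof.
move=> [a0 [a1 [[ga0 gs0] [ga1 gs1] ->]]].
exists (star a0), (star a1); split; [by split; rewrite ?starK..|].
by congr (_, _); rewrite /= ?starB ?starD.
Qed.

Lemma graded_pair1 : graded_pair 1.
Proof.
pose g := fock_gen (Ordinal hn); have [gg _] := fock_gen_rel.
have g1 : graded_pair (g, - g).
  exists 0, g; split.
  - by rewrite -(scale0r 1); exact: star_graded_scalar.
  - exact: star_graded_gen.
  - by rewrite add0r sub0r.
have <- : star (g, - g) * (g, - g) = 1.
  congr (_, _); first exact: gg.
  by rewrite -[LHS]/(star (- g) * - g) starN mulNr mulrN opprK; exact: gg.
exact: graded_pairM (graded_pair_star g1) g1.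
Qed.

(** The inverse [b'] is not assumed graded: its commutation up to finite rank follows from that of
    [b] by multiplying by [b'] on both sides. *)
Lemma graded_not_invertible b : star_graded true b -> invertible b -> False.
Proof.
move=> [[bP bC] _] [b' [b'b bb']].
apply: (@no_self_similar_inverse _ _ _ P (vacuum hn HS) C (annihilation hn HS)
  _ _ _ _ _ (lact b) (lact b') _ _ _ _ hn).
- exact: parity_op_idem.
- exact: annihilation_creation.
- exact: parity_creation.
- exact: vacuum_trace.
- exact: parity_op_dec.
- by rewrite -lactM bb' lact1.
- by rewrite -lactM b'b lact1.
- by move=> d; have := bP d; rewrite addbT.
- exact: bC.
Qed.

End AlmostCommuting.

(** By uniqueness the second coordinate of [F] is the first one composed with [al], so [F y] has the
    form (y1, - y1). The odd part of a graded pair close to [F y] is then close to y1, hence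
    invertible. *)
Lemma no_odd_invertible (R : realType) (n : nat) (O : cuntzAlgebra R n)
    (al : O -> O) (y : O) : (2 <= n)%N -> unital_star_hom al ->
  (forall i, al (cuntz_gen O i) = - cuntz_gen O i) ->
  al y = - y -> invertible y -> False.
Proof.
move=> hn alH alS aly [y' [y'y yy']].
have HS := (cuntz_genP O).1.
pose G := fock_gen hn HS; pose M := stab (digit_basis hn (cuntz_gen O)).
have GG : cuntz_rel (fun i => (G i, - G i) : (M * M)%type).
  have [g1 g2] := fock_gen_rel hn HS; split=> [i|].
    by congr (_, _); rewrite /= ?starN ?mulNr ?mulrN ?opprK; exact: g1.
  rewrite [LHS]surjective_pairing; congr (_, _).
    by rewrite (big_morph fst (fun _ _ => erefl) erefl) -[RHS]g2.
  rewrite (big_morph snd (fun _ _ => erefl) erefl) -[RHS]g2.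
  by apply: eq_bigr => i _; rewrite /= starN mulNr mulrN opprK.
have [|F [FH FS] Fd] := cuntz_hom_dense O GG (graded_pair1 hn HS)
  (@graded_pairP _ _ _ hn _ HS) (@graded_pairM _ _ _ hn _ HS)
  (@graded_pair_star _ _ _ hn _ HS).
  move=> i; exists 0, (G i); split; last by rewrite add0r sub0r.
    by rewrite -(scale0r 1); exact: star_graded_scalar.
  exact: star_graded_gen.
have f1 : unital_star_hom (fst \o F) by exact: unital_star_hom_comp FH (fst_hom _ _).
have f2 : unital_star_hom (snd \o F) by exact: unital_star_hom_comp FH (snd_hom _ _).
have FN x : F (- x) = - F x.
  by rewrite -scaleN1r (uhomZ FH) scaleN1r.
have Fal : snd \o F = fst \o F \o al.
  apply: cuntz_hom_unique => //; first exact: unital_star_hom_comp alH f1.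
  by move=> i; rewrite /= alS FN FS.
have Fy : (F y).2 = - (F y).1.
  by rewrite -[LHS]/((snd \o F) y) Fal /= aly FN.
have Fy_inv : invertible (F y).1.
  exists (F y').1; split.
    by rewrite -[LHS]/((F y' * F y).1) -(uhomM FH) y'y (uhom1 FH).
  by rewrite -[LHS]/((F y * F y').1) -(uhomM FH) yy' (uhom1 FH).
have [eps eps0 near] := invertible_near Fy_inv.
have [_ [b0 [b1 [_ gb1 ->]]] Fyb] := Fd y _ eps0.
apply: (graded_not_invertible gb1); apply: near.
(* The even part [b0] cancels in the difference of the two errors. *)
have E : ((F y).1 - b1) *+ 2 = ((F y).1 - (b0 + b1)) - ((F y).2 - (b0 - b1)).
  rewrite Fy mulr2n !opprD !opprK [RHS]addrACA [- b0 - b1 + _]addrACA addNr.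
  by rewrite add0r addrACA.
have h1 : cnorm ((F y).1 - (b0 + b1)) < eps.
  by apply: le_lt_trans Fyb; rewrite le_max lexx.
have h2 : cnorm ((F y).2 - (b0 - b1)) < eps.
  by apply: le_lt_trans Fyb; rewrite le_max lexx orbT.
have : cnorm (((F y).1 - b1) *+ 2) < eps + eps.
  by rewrite E; apply: le_lt_trans (cnormD_le _ _) _; rewrite cnormN ltrD.
rewrite -scaler_nat cnormZc -(rmorph_nat (real_complex R)) normc_real//.
lra.
Qed.

(** * Cone functions *)

Section ConeFunctions.
Variables (R : realType) (m : nat).
Local Notation G := (mu2 R m).

Lemma cone_id_continuous : continuous (@cone_id R).
Proof.
have cval : continuous (set_val : unit_Ioc R -> R) by exact: initial_continuous.
move=> t; apply/(@cvgrPdist_lt _ _ _ _ (nbhs_filter t)) => eps eps0.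
have [e e0 epsE] : exists2 e : R, 0 < e & eps = e%:C.
  case: eps eps0 => a b; rewrite ltcE /= => /andP[/eqP b0 a0].
  by exists a; rewrite ?b0.
have /(@cvgrPdist_lt _ _ _ _ (nbhs_filter t))/(_ _ e0) := cval t.
apply: (@filterS _ _ (nbhs_filter t)) => s.
by rewrite /cone_id epsE -rmorphB normc_def /= expr0n addr0 sqrtr_sqr ltcR.
Qed.

Lemma tensor_continuous (f : G -> R[i]^o) :
  continuous (tensor (@cone_id R) f).
Proof.
move=> x; apply: cvgM.
  apply: (cvg_comp _ _ (cvg_fst)); exact: cone_id_continuous.
apply: (cvg_comp _ _ (cvg_snd)) => B fB; apply: mu2_near.
exact: nbhs_singleton fB.
Qed.

Lemma tensor_C0 (f : G -> R[i]^o) : (forall h, `|f h| = 1) ->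
  C0 (tensor (@cone_id R) f).
Proof.
move=> f1; split; first exact: tensor_continuous.
move=> eps eps0.
have [e e0 epsE] : exists2 e : R, 0 < e & eps = e%:C.
  case: eps eps0 => a b; rewrite ltcE /= => /andP[/eqP b0 a0].
  by exists a; rewrite ?b0.
(* The compact set is {t >= a}, obtained as the image of [0,1] under clamping to [a,1]; the minimum
   with 1 keeps this interval inside (0,1]. *)
pose a := Num.min e 1.
have a0 : 0 < a by rewrite lt_min e0 ltr01.
have clampP (s : R) : `]0, 1]%classic (Num.max a (Num.min s 1)).
  by rewrite /= in_itv /= lt_max a0/= ge_max !ge_min lexx !orbT.
pose g (s : R) : unit_Ioc R := exist _ (Num.max a (Num.min s 1)) (mem_set (clampP s)).
have gc : continuous g.
  apply: continuous_comp_initial => s.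
  have := @continuous_max R R (fun=> a) (fun x => Num.min x 1) s; apply.
    exact: cvg_cst.
  have := @continuous_min R R id (fun=> 1) s.
  by apply; [exact: cvg_id|exact: cvg_cst].
exists ((g @` `[0, 1]%classic) `*` [set: G]).
  apply: compact_setX; last exact: mu2_compact.
  apply: continuous_compact; last exact: segment_compact.
  exact: continuous_subspaceT.
move=> x xK; rewrite /tensor normrM f1 mulr1 /cone_id epsE.
have x01 : 0 < (set_val x.1 : R) <= 1.
  by have := set_valP x.1; rewrite /= in_itv.
rewrite normc_def /= expr0n addr0 sqrtr_sqr ltcR gtr0_norm; last by case/andP: x01.
rewrite ltNge; apply/negP => ex; apply: xK; split => //.
exists (set_val x.1); first by rewrite /= in_itv /= ltW; case/andP: x01.
apply: val_inj => /=; case/andP: x01 => x0 x1.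
by rewrite (min_idPl x1); apply/max_idPr; rewrite /a ge_min ex.
Qed.

End ConeFunctions.

(** * Equivariant projections *)

Section CyclicProjections.
Variables (R : realType) (A : cstarType R) (n : nat) (S : 'I_n -> A).
Hypothesis HS : cuntz_rel S.
Variables (N : nat) (zeta : R[i]) (w : 'I_n).
Hypothesis zetaP : N.-primitive_root zeta.

Lemma starX (x : A) k : star (x ^+ k) = star x ^+ k.
Proof.
by elim: k => [|k IH]; rewrite ?star1// exprS exprSr starM IH.
Qed.

Lemma isometry_expK (x : A) k : star x * x = 1 -> star x ^+ k * x ^+ k = 1.
Proof.
move=> xx; elim: k => [|k IH]; first by rewrite mulr1.
by rewrite exprSr exprS -mulrA [star x * _]mulrA xx mul1r.
Qed.

Lemma conjcX (c : R[i]) k : (c ^+ k)^* = c^* ^+ k.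
Proof. exact: (rmorphXn Num.conj). Qed.

Definition spoke r d := S w ^+ r * S d.

Lemma spoke_ortho r s d d' : d != w -> d' != w ->
  star (spoke r d) * spoke s d' = ((r == s) && (d == d'))%:R.
Proof.
move=> dw d'w; have [SS _] := HS.
have low k c c' : c != w -> star (S c) * (S w ^+ k.+1 * S c') = 0.
  by move=> cw; rewrite exprS !mulrA (cuntz_ortho HS cw) !mul0r.
have lt a b c c' : (a < b)%N -> c != w -> star (spoke a c) * spoke b c' = 0.
  move=> ab cw; rewrite /spoke starM starX -(subnKC (ltnW ab)) exprD -!mulrA.
  rewrite [star (S w) ^+ a * _]mulrA isometry_expK// mul1r.
  by rewrite -(prednK (_ : 0 < b - a)%N) ?subn_gt0// low.
have [rs|sr|->] := ltngtP r s.
- by rewrite lt.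
- by rewrite -[LHS]starK starM starK lt// star0.
rewrite /spoke starM starX -mulrA [star (S w) ^+ s * _]mulrA isometry_expK//.
rewrite mul1r /=; have [->|dd] := eqVneq d d'; first exact: SS.
exact: cuntz_ortho.
Qed.

Lemma prim_root_circle : zeta^* * zeta = 1.
Proof.
have N0 := prim_order_gt0 zetaP.
rewrite normc_conjM.
have /eqP : normc zeta ^+ N = 1.
  by rewrite -normcX (prim_expr_order zetaP) normc1.
by rewrite pexpr_eq1 ?normc_ge0// => /eqP->; rewrite expr1n.
Qed.

Lemma char_sum (i j : 'I_N) :
  \sum_(r < N) (zeta ^+ i * (zeta ^+ j)^*) ^+ r = N%:R * (i == j)%:R.
Proof.
have zz := prim_root_circle.
have zeta0 : zeta != 0 by rewrite (prim_root_eq0 zetaP) -lt0n (prim_order_gt0 zetaP).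
have zc : zeta^* = zeta ^+ N.-1.
  apply: (mulIf (zeta0)); rewrite zz -exprSr prednK.
    by rewrite (prim_expr_order zetaP).
  exact: prim_order_gt0 zetaP.
have -> : zeta ^+ i * (zeta ^+ j)^* = zeta ^+ (i + N.-1 * j)%N.
  rewrite exprD exprM; congr (_ * _); apply: (etrans (conjcX _ _)).
  by congr (_ ^+ j); exact: zc.
rewrite (sum_prim_root _ zetaP).
have -> : (N %| i + N.-1 * j)%N = (i == j).
  apply/idP/eqP => [dv|->]; last first.
    by rewrite -mulSn prednK ?dvdn_mulr//; exact: prim_order_gt0 zetaP.
  apply/val_inj/eqP; rewrite /= -[X in X == _](modn_small (ltn_ord i)).
  rewrite -[X in _ == X](modn_small (ltn_ord j)).
  have := modnMDl j i N; rewrite mulnC => <-.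
  have -> : (N * j + i = (i + N.-1 * j) + j)%N.
    by have := prim_order_gt0 zetaP; nia.
  by rewrite -modnDml (eqP dv) add0n.
by case: (i == j); rewrite ?mulr0 ?mulr1.
Qed.

(* The Fourier transform along the cycle of the N levels of spokes. *)
Definition fourier (z : R[i]) d := \sum_(r < N) z^* ^+ r *: spoke r d.

Lemma fourier_ortho (i j : 'I_N) d d' : d != w -> d' != w ->
  star (fourier (zeta ^+ i) d) * fourier (zeta ^+ j) d' =
  (N%:R * ((i == j) && (d == d'))%:R) *: 1.
Proof.
move=> dw d'w; rewrite /fourier star_sum mulr_suml.
transitivity (\sum_(r < N) ((zeta ^+ i * (zeta ^+ j)^*) ^+ r * (d == d')%:R) *: (1 : A)).
  apply: eq_bigr => r _; rewrite mulr_sumr (bigD1 r)//= big1 ?addr0; last first.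
    move=> s sr; rewrite starZ -scalerAl -scalerAr spoke_ortho//.
    by rewrite eq_sym (negbTE (sr : _ != r :> nat)) !scaler0.
  rewrite starZ -scalerAl -scalerAr spoke_ortho// eqxx /= scalerA.
  rewrite -[(d == d')%:R]mul1r mulr_natr -scaler_nat scalerA; congr (_ *: _).
  rewrite exprMn; congr (_ * _ * _).
  by apply: (etrans (conjcX _ _)); congr (_ ^+ r); exact: conjcK.
by rewrite -scaler_suml -mulr_suml char_sum -mulrA -natrM mulnb.
Qed.

(** By [fourier_ortho] the vectors [fourier z d] have squared norm N when z is a power of [zeta];
    dividing by N turns the sum into the projection onto their ranges. *)
Definition cproj (z : R[i]) : A :=
  N%:R^-1 *: \sum_(d | d != w) fourier z d * star (fourier z d).

Lemma cproj_star z : star (cproj z) = cproj z.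
Proof.
rewrite /cproj starZ star_sum; congr (_ *: _).
  by apply: (etrans (fmorphV Num.conj _)); rewrite rmorph_nat.
by apply: eq_bigr => d _; rewrite starM starK.
Qed.

Lemma NK : (N%:R^-1 * N%:R : R[i]) = 1.
Proof.
by rewrite mulVf// pnatr_eq0 -lt0n; exact: prim_order_gt0 zetaP.
Qed.

Lemma cprojM (i j : 'I_N) :
  cproj (zeta ^+ i) * cproj (zeta ^+ j) = if i == j then cproj (zeta ^+ i) else 0.
Proof.
rewrite /cproj -scalerAl -scalerAr mulr_suml.
rewrite (eq_bigr (fun d => (N%:R * (i == j)%:R) *:
    (fourier (zeta ^+ i) d * star (fourier (zeta ^+ j) d)))) => [|d dw].
  rewrite -scaler_sumr !scalerA; case: eqVneq => [->|]; last first.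
    by rewrite !mulr0 scale0r.
  by rewrite mulr1 -mulrA NK mulr1.
rewrite mulr_sumr (bigD1 d)//= big1 ?addr0 => [|d' /andP[d'w d'd]].
  rewrite -mulrA [star _ * (_ * _)]mulrA fourier_ortho// eqxx andbT.
  by rewrite -scalerAl mul1r scalerAr.
rewrite -mulrA [star _ * (_ * _)]mulrA fourier_ortho// [d == d']eq_sym (negbTE d'd).
by rewrite andbF mulr0 scale0r mul0r mulr0.
Qed.

(** Each term is the difference of the range projections of [S w ^+ r] and [S w ^+ r.+1]. *)
Lemma telescope_isometry k :
  \sum_(r < k) S w ^+ r * (1 - S w * star (S w)) * star (S w) ^+ r =
  1 - S w ^+ k * star (S w) ^+ k.
Proof.
elim: k => [|k IH]; first by rewrite big_ord0 mulr1 subrr.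
rewrite big_ord_recr /= IH mulrBr mulr1 mulrBl addrA subrK.
by rewrite exprSr [star _ ^+ k.+1]exprS !mulrA.
Qed.

(** Orthogonality of characters removes the cross terms between different levels, leaving the range
    projections of all spokes. *)
Lemma cproj_sum :
  \sum_(i < N) cproj (zeta ^+ i) = 1 - S w ^+ N * star (S w) ^+ N.
Proof.
rewrite -telescope_isometry -scaler_sumr exchange_big /=.
have dsum : \sum_(d | d != w) S d * star (S d) = 1 - S w * star (S w).
  by apply/esym/eqP; rewrite subr_eq addrC -HS.2 [X in X == _](bigD1 w).
under [RHS]eq_bigr => r _ do rewrite -dsum mulr_sumr mulr_suml.
rewrite [RHS]exchange_big /= scaler_sumr; apply: eq_bigr => d dw.
rewrite (eq_bigr (fun i : 'I_N => \sum_(r < N) \sum_(s < N)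
   ((zeta ^+ s * (zeta ^+ r)^*) ^+ i) *: (spoke r d * star (spoke s d)))).
  rewrite exchange_big /= scaler_sumr; apply: eq_bigr => r _.
  rewrite exchange_big /=.
  under eq_bigr => s _ do rewrite -scaler_suml char_sum.
  rewrite (bigD1 r)//= eqxx mulr1 big1 ?addr0 => [|s sr]; last first.
    by rewrite (negbTE sr) mulr0 scale0r.
  by rewrite scalerA NK scale1r /spoke starM starX !mulrA.
move=> i _; rewrite /fourier mulr_suml; apply: eq_bigr => r _.
rewrite star_sum mulr_sumr; apply: eq_bigr => s _.
rewrite starZ -scalerAl -scalerAr scalerA; congr (_ *: _).
rewrite [LHS]mulrC [RHS]exprMn; congr (_ * _).
  transitivity ((zeta ^+ i) ^+ s); last by rewrite -!exprM mulnC.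
  by apply: (etrans (conjcX _ _)); congr (_ ^+ s); exact: conjcK.
transitivity ((zeta^* ^+ i) ^+ r); first by congr (_ ^+ r); exact: conjcX.
transitivity ((zeta^* ^+ r) ^+ i); first by rewrite -!exprM mulnC.
by congr (_ ^+ i); exact/esym/conjcX.
Qed.

(** Level r is multiplied by g^(r+1). The part g^r is absorbed into the Fourier parameter, and the
    remaining g cancels against its conjugate. *)
Lemma cproj_gauge (phi : A -> A) (g z : R[i]) :
  unital_star_hom phi -> (forall i, phi (S i) = g *: S i) -> g^* * g = 1 ->
  phi (cproj z) = cproj (z * g^*).
Proof.
move=> [fD fZ fM f1 fs] fS gg.
have f0 : phi 0 = 0 by apply: (addrI (phi 0)); rewrite -fD !addr0.
have fX x k : phi (x ^+ k) = phi x ^+ k.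
  by elim: k => [|k IH]; rewrite ?expr0// !exprS fM IH.
have f_fourier d : phi (fourier z d) = g *: fourier (z * g^*) d.
  rewrite /fourier (big_morph phi fD f0) scaler_sumr; apply: eq_bigr => r _.
  rewrite fZ fM fX !fS exprZn -scalerAl -scalerAr !scalerA; congr (_ *: _).
  have E : (z * g^*)^* = z^* * g by rewrite rmorphM /= conjcK.
  transitivity (g * (z^* * g) ^+ r); first by rewrite exprMn; ring.
  by congr (_ * _ ^+ r); exact/esym/E.
rewrite /cproj fZ (big_morph phi fD f0); congr (_ *: _); apply: eq_bigr => d _.
rewrite fM fs f_fourier starZ -scalerAl -scalerAr scalerA mulrC.
rewrite -[X in X *: _]/(g^* * g) gg scale1r.
by [].
Qed.

End CyclicProjections.

(** * Weak local-triviality dimension of the gauge action *)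

Lemma sum_periodic (V : zmodType) (psi : nat -> V) N k :
  (forall i, psi (i + N)%N = psi i) ->
  \sum_(i < N) psi (i + k)%N = \sum_(i < N) psi i.
Proof.
move=> per; elim: k => [|k IH]; first by under eq_bigr do rewrite addn0.
rewrite -[RHS]IH; case: N per {IH} => [|N] per; first by rewrite !big_ord0.
rewrite [LHS]big_ord_recr [RHS]big_ord_recl [LHS]addrC /=; congr (_ + _).
  by rewrite -(per (0 + k)%N); congr psi; lia.
by apply: eq_bigr => i _; congr psi; rewrite /bump; lia.
Qed.

Section Witness.
Variables (R : realType) (n m : nat) (O : cuntzAlgebra R n).
Local Notation G := (mu2 R m).
Local Notation S := (cuntz_gen O).
Local Notation N := (2 ^ m)%N.
Variable zeta : R[i].
Hypothesis zetaP : N.-primitive_root zeta.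

Let HS : cuntz_rel S := (cuntz_genP O).1.

Lemma root_power_subproof k : (zeta ^+ k) ^+ N = 1.
Proof. by rewrite exprAC (prim_expr_order zetaP) expr1n. Qed.

Definition root_power k : G := mu2_mk (root_power_subproof k).

Lemma unit_Ioc1_subproof : `]0, 1]%classic (1 : R).
Proof. by rewrite /= in_itv /= ltr01 lexx. Qed.

Definition unit_Ioc1 : unit_Ioc R := exist _ (1 : R) (mem_set unit_Ioc1_subproof).

(* Evaluation at the tip 1 of (0,1], followed by the homomorphism from C(Z/N)
   given by the projections cproj. *)
Definition cone_eval w (F : cone R G -> R[i]^o) : O :=
  \sum_(i < N) (F (unit_Ioc1, root_power i) : R[i]) *: cproj S N w (zeta ^+ i).

Lemma cone_eval_hom w : C0_star_hom (cone_eval w).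
Proof.
split.
- move=> f g _ _; rewrite /cone_eval -big_split; apply: eq_bigr => i _.
  exact: scalerDl.
- move=> c f _; rewrite /cone_eval scaler_sumr; apply: eq_bigr => i _.
  by rewrite scalerA.
- move=> f g _ _; rewrite /cone_eval mulr_suml; apply: eq_bigr => i _.
  rewrite mulr_sumr (bigD1 i)//= big1 ?addr0 => [|j ji].
    by rewrite -scalerAl -scalerAr cprojM// eqxx [RHS]scalerA.
  by rewrite -scalerAl -scalerAr cprojM// eq_sym (negbTE ji) !scaler0.
- move=> f _; rewrite /cone_eval star_sum; apply: eq_bigr => i _.
  by rewrite starZ cproj_star.
Qed.

Lemma cone_eval_id w :
  cone_eval w (tensor (@cone_id R) (fun=> 1)) = 1 - S w ^+ N * star (S w) ^+ N.
Proof.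
rewrite -(cproj_sum HS w zetaP); apply: eq_bigr => i _.
by rewrite /tensor /cone_id /= mulr1 scale1r.
Qed.

(** If g is the k-th power of [zeta], translation moves the evaluation points forward by k and the
    gauge action moves the projections back by k; a cyclic change of index matches the two. *)
Lemma cone_eval_equivariant w : equivariant (gauge_mu2 O) (cone_eval w).
Proof.
move=> g F _; have [k gk] := prim_rootP zetaP (mu2P g).
pose c : R[i] := set_val g.
have cc : c^* * c = 1 by exact: circle_conjM (mu2_circle g).
have [gD gZ _ _ _] := gauge_hom O (mu2_circle g).
pose phi := gauge O (mu2_circle g).
have phi0 : phi 0 = 0 by apply: (addrI (phi 0)); rewrite -gD !addr0.
rewrite -[RHS]/(phi _) {2}/cone_eval (big_morph phi gD phi0).
pose psi i := (F (unit_Ioc1, root_power i) : R[i]) *: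
  cproj S N w (zeta ^+ i * c^*).
transitivity (\sum_(i < N) psi i); last first.
  apply: eq_bigr => i _; rewrite /phi gZ; congr (_ *: _); apply/esym.
  apply: cproj_gauge cc; first exact: gauge_hom.
  by move=> l; exact: gauge_gen.
have rpD i l : root_power (i + l) = (root_power i * root_power l)%g.
  by apply: mu2_inj; exact: exprD.
rewrite -(@sum_periodic _ psi N k) => [|i]; last first.
  have zN : zeta ^+ (i + N) = zeta ^+ i.
    by rewrite exprD (prim_expr_order zetaP) mulr1.
  rewrite /psi zN; congr ((F (_, _) : R[i]) *: _).
  by apply: mu2_inj; exact: zN.
apply: eq_bigr => i _; rewrite /psi rpD; congr (_ *: _).
  by congr (F (_, (_ * _)%g)); apply: mu2_inj; exact: gk.
congr (cproj _ _ _ _); rewrite exprD -(gk : c = _) -mulrA [c * _]mulrC.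
by rewrite [X in _ * X](cc : _ = 1) mulr1.
Qed.

End Witness.

(** The element acts as 1 on the range of [p] and as 2 on its complement, so its inverse is (1 + p)
    / 2. *)
Lemma invertible_two_minus_idem (R : realType) (A : cstarType R) (p : A) :
  p * p = p -> invertible (1 + (1 - p)).
Proof.
move=> pp; pose b : A := 2^-1 *: (1 + p).
have half : 2^-1 *: (1 + 1 : A) = 1.
  have -> : 1 + 1 = 2%:R *: 1 :> A by rewrite scaler_nat mulr2n.
  by rewrite scalerA mulVf ?pnatr_eq0// scale1r.
have p0 : (1 - p) * p = 0 by rewrite mulrBl mul1r pp subrr.
have p0' : p * (1 - p) = 0 by rewrite mulrBr mulr1 pp subrr.
exists b; split.
  rewrite /b -scalerAl mulrDr mulr1 mulrDl mul1r p0' addr0 -addrA.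
  by rewrite [p + _]addrC subrK.
rewrite /b -scalerAr mulrDl mul1r mulrDr mulr1 p0 addr0 -addrA.
by rewrite [p + _]addrC subrK.
Qed.

Lemma conj_real_mul (R : realType) (t : R) (c : R[i]) :
  (t%:C * c)^* = t%:C * c^*.
Proof.
by case: c => a b; apply/eqP; rewrite eq_complex /=; apply/andP; split;
  apply/eqP; ring.
Qed.

(** * Upper and lower bounds for the dimension *)

Section Dimension.
Variables (R : realType) (n m : nat) (O : cuntzAlgebra R n).
Hypothesis hn : (2 <= n)%N.
Local Notation S := (cuntz_gen O).
Local Notation N := (2 ^ m)%N.

Lemma WLT_witness1 : WLT_witness (@gauge_mu2 R m n O) 1.
Proof.
have HS : cuntz_rel S := (cuntz_genP O).1.
have [SS _] := HS.
have [zeta zetaP] := dyadic_primitive_root R m.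
pose i0 : 'I_n := Ordinal (ltnW hn); pose i1 : 'I_n := Ordinal hn.
exists (fun k : 'I_2 => cone_eval O zetaP (if k == ord0 then i0 else i1)); split.
  by move=> k; split; [exact: cone_eval_hom|exact: cone_eval_equivariant].
rewrite big_ord_recl big_ord1 /= !cone_eval_id.
pose p i := S i ^+ N * star (S i) ^+ N.
have pp i : p i * p i = p i.
  by rewrite /p mulrA -[_ * _ * S i ^+ N]mulrA isometry_expK// mulr1.
have pq i j : i != j -> p i * p j = 0.
  move=> ij; rewrite /p mulrA -[_ * _ * S j ^+ N]mulrA.
  have : (0 < N)%N by rewrite expn_gt0.
  case: N => // k _.
  have -> : star (S i) ^+ k.+1 * S j ^+ k.+1 = 0.
    rewrite exprSr exprS mulrA -[_ * star (S i) * _]mulrA.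
    by rewrite (cuntz_ortho HS ij) mulr0 mul0r.
  by rewrite mulr0 mul0r.
(* The two units add up to 2 minus [p i0 + p i1], which is idempotent because the letters have
   orthogonal ranges. *)
have := @invertible_two_minus_idem _ O (p i0 + p i1).
have -> : 1 + (1 - (p i0 + p i1)) = 1 - p i0 + (1 - p i1).
  by rewrite addrACA -opprD addrA.
by apply; rewrite mulrDl !mulrDr !pp !pq// addr0 add0r.
Qed.

Lemma not_WLT_witness0 : (1 <= m)%N -> ~ WLT_witness (@gauge_mu2 R m n O) 0.
Proof.
move=> hm [rho [/(_ ord0) [[rD rZ rM rs] rE]]].
rewrite big_ord1; set r := rho ord0; set a := r _ => a_inv.
pose chi (h : mu2 R m) : R[i]^o := set_val h.
have chi1 h : `|chi h| = 1 by exact: mu2_circle.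
have chiC h : (chi h)^* * chi h = 1 by exact: circle_conjM (mu2_circle h).
pose F := tensor (@cone_id R) chi; pose y := r F.
have F0 : C0 F by exact: tensor_C0.
have F0' : C0 (tensor (@cone_id R) (fun h : mu2 R m => (chi h)^*)).
  by apply: tensor_C0 => h; rewrite normcJ.
have E0 : C0 (tensor (@cone_id R) (fun _ : mu2 R m => 1)).
  by apply: tensor_C0 => h; rewrite normr1.
have FJ : (fun x => (F x)^*) = tensor (@cone_id R) (fun h : mu2 R m => (chi h)^*).
  by apply/funext => x; exact: conj_real_mul.
(* Since |chi| = 1, both products are the image of t^2 (x) 1, the square of the invertible [a]. *)
have yy : star y * y = a * a.
  rewrite -rs// FJ -rM// /a -rM//; congr r.
  apply/funext => x; rewrite /F /tensor mulrACA [RHS]mulrACA mulr1.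
  by congr (_ * _); exact: chiC.
have yy' : y * star y = a * a.
  rewrite -rs// FJ -rM// /a -rM//; congr r.
  apply/funext => x; rewrite /F /tensor mulrACA [RHS]mulrACA mulr1.
  by congr (_ * _); rewrite mulrC; exact: chiC.
have y_inv : invertible y.
  apply: (@invertible_sides _ _ _ (star y) (star y)).
    by rewrite yy; exact: invertible_mul.
  by rewrite yy'; exact: invertible_mul.
(* This is where [1 <= m] enters: the order of the group is even, so -1 belongs to it. *)
have m1_subproof : (-1 : R[i]) ^+ N = 1.
  by rewrite -(prednK hm) expnS exprM sqrrN expr1n expr1n.
pose g : mu2 R m := mu2_mk m1_subproof.
apply: (@no_odd_invertible R n O (gauge O (mu2_circle g)) y hn) => //.
- exact: gauge_hom.
- by move=> i; rewrite gauge_gen scaleN1r.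
rewrite -[LHS]/(gauge_mu2 O g (r F)) -(rE g F F0) -/r.
have := rZ (-1) F F0; rewrite scaleN1r => <-; congr (rho _ _).
apply/funext => x; rewrite /translate /F /tensor [RHS]mulrCA; congr (_ * _).
exact: (mulrC (set_val x.2 : R[i]) (-1)).
Qed.

End Dimension.

Theorem proposition5p4 (R : realType) (n m : nat) (hn : (2 <= n)%N)
    (hm : (1 <= m)%N) (O : cuntzAlgebra R n) :
  dim_WLT (@gauge_mu2 R m n O) = Some 1%N.
Proof.
have w1 := WLT_witness1 m O hn.
have w0 := @not_WLT_witness0 R n m O hn hm.
rewrite /dim_WLT /least_nat; case: pselect => [ex|[]]; last first.
  by exists 1%N; apply/asboolP.
case: ex_minnP => k /asboolP wk kmin; congr Some.
have : (k <= 1)%N by apply: kmin; apply/asboolP.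
by case: k wk {kmin} => [/w0|[|k]].
Qed.
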